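(* Let $k\ge3$, $t\in\mathbb{C}^{n_1}\otimes\cdots\otimes\mathbb{C}^{n_k}$ and $\theta\in\mathcal{P}([k])$ with $\theta(i)>0$ for all $i$. If $F^\theta(t)<n_1^{\theta(1)}\cdots n_k^{\theta(k)}$, then $\zeta^\theta(t)<n_1^{\theta(1)}\cdots n_k^{\theta(k)}$.
   Context: $H$ is Shannon entropy base 2. Upper quantum functional: $E^\theta(t)=\sup\sum_j\theta(j)H(\overline{\lambda^{(j)}})$ over all $m\ge1$ and partitions $\lambda^{(j)}\vdash m$ with $(P_{\lambda^{(1)}}\otimes\cdots\otimes P_{\lambda^{(k)}})t^{\otimes m}\ne0$, where $P_\lambda$ projects $(\mathbb{C}^{n_j})^{\otimes m}$ onto the $\lambda$-isotypic component of the Schur–Weyl decomposition $(\mathbb{C}^{n_j})^{\otimes m}\cong\bigoplus_{\lambda\vdash m}\mathbb{S}_\lambda\otimes[\lambda]$ (acting on the $j$-th legs of $(\mathbb{C}^{n_1}\otimes\cdots\otimes\mathbb{C}^{n_k})^{\otimes m}$), $\overline\lambda=(\lambda_1/m,\dots)$; $F^\theta(t)=2^{E^\theta(t)}$ ($0$ for $t=0$). Strassen upper support functional: for a $k$-tuple $C$ of bases, $\operatorname{supp}_Ct$ is the set of index tuples $\alpha\in[n_1]\times\cdots\times[n_k]$ with nonzero coefficient of $v_{1,\alpha_1}\otimes\cdots\otimes v_{k,\alpha_k}$; $\zeta^\theta(t)=2^{\rho^\theta(t)}$ with $\rho^\theta(t)=\min_C\max_{P\in\mathcal{P}(\operatorname{supp}_Ct)}\sum_i\theta(i)H(P_i)$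 ($\zeta^\theta(0)=0$). *)

(* Defs.v *)
From HB Require Import structures.
From mathcomp Require Import all_boot all_order all_algebra all_fingroup.
From mathcomp Require Import mxrepresentation complex.
From mathcomp Require Import boolp classical_sets reals exp.

Set Implicit Arguments.
Unset Strict Implicit.
Unset Printing Implicit Defensive.

Import Order.TTheory GRing.Theory Num.Theory.

Local Open Scope ring_scope.
Local Open Scope complex_scope.

Section Entropy.
Variable R : realType.

Definition is_dist (T : finType) (p : T -> R) : Prop :=
  (forall x, 0 <= p x) /\ \sum_x p x = 1.

Definition log2 (x : R) : R := ln x / ln 2.

(* The convention 0 * log2 0 = 0 holds because of the factor p x. *)
Definition entropy (T : finType) (p : T -> R) : R :=
  - \sum_x p x * log2 (p x).

End Entropy.

Section Partitions.

Definition is_partition (m : nat) (la : seq nat) : bool :=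
  [&& sorted geq la, 0%N \notin la & sumn la == m].

Definition normalized_partition (R : realType) (m : nat) (la : seq nat)
    (i : 'I_(size la)) : R := (nth 0%N la i)%:R / m%:R.

(* The tableau of shape la is filled with 0, ..., m-1 row after row: the entry
   e sits in row reshape_index la e and column reshape_offset la e. *)
Definition row_stab (m : nat) (la : seq nat) : {set 'S_m} :=
  [set s : 'S_m |
    [forall e, reshape_index la (s e) == reshape_index la e]].

Definition col_stab (m : nat) (la : seq nat) : {set 'S_m} :=
  [set s : 'S_m |
    [forall e, reshape_offset la (s e) == reshape_offset la e]].

End Partitions.

Section SchurWeyl.
Variables (C : decFieldType) (n m : nat).

Definition regular_Sm := regular_repr C [set: 'S_m]%G.

Definition young_symmetrizer (la : seq nat) : 'M[C]_#|[set: 'S_m]| :=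
  \sum_(p in row_stab m la) \sum_(q in col_stab m la)
    (-1) ^+ odd_perm q *: regular_Sm (p * q)%g.

(* The irreducible representation [la] of S_m, as the right ideal of the group
   algebra generated by the Young symmetrizer (representations act on row
   vectors from the right). *)
Definition specht_repr (la : seq nat) :=
  submod_repr (cyclic_mx_module regular_Sm
                 (gring_row (young_symmetrizer la))).

(* The tensor power (C^n)^{(x) m} is identified with the row space
   'rV[C]_#|word|: a word w stands for e_{w 0} (x) ... (x) e_{w (m-1)}. *)
Definition word := {ffun 'I_m -> 'I_n}.

Definition place_word (w : word) (s : 'S_m) : word :=
  [ffun l => w (s^-1%g l)].

Definition place_mx (s : 'S_m) : 'M[C]_#|{: word}| :=
  \matrix_(a, b) (enum_val b == place_word (enum_val a) s)%:R.

Lemma place_mx_repr : mx_repr [set: 'S_m] place_mx.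
Proof.
split=> [|s u _ _].
  apply/matrixP=> a b; rewrite !mxE eq_sym; congr (_%:R); congr nat_of_bool.
  have -> : place_word (enum_val a) 1 = enum_val a.
    by apply/ffunP=> l; rewrite ffunE invg1 perm1.
  by rewrite (inj_eq enum_val_inj).
apply/matrixP=> a b; rewrite !mxE.
rewrite (bigD1 (enum_rank (place_word (enum_val a) s))) //= !mxE enum_rankK.
rewrite eqxx mul1r big1 ?addr0 => [|c].
  congr ((_ == _)%:R); apply/ffunP=> l.
  by rewrite !ffunE invMg permM.
by rewrite -(inj_eq enum_val_inj) enum_rankK !mxE => /negPf->; rewrite mul0r.
Qed.

Definition place_repr := MxRepresentation place_mx_repr.

(* DecSocleType place_repr enumerates the isotypic components of
   (C^n)^{(x) m}; the la-component is the one whose simple submodules are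
   isomorphic to [la], and both the sum and P_la are 0 if there is none. *)
Definition isotypic (la : seq nat) : 'M[C]_#|{: word}| :=
  (\sum_(W : DecSocleType place_repr |
         `[< mx_rsim (socle_repr W) (specht_repr la) >]) W)%MS.

Definition coisotypic (la : seq nat) : 'M[C]_#|{: word}| :=
  (\sum_(W : DecSocleType place_repr |
         ~~ `[< mx_rsim (socle_repr W) (specht_repr la) >]) W)%MS.

Definition isotypic_proj (la : seq nat) : 'M[C]_#|{: word}| :=
  proj_mx (isotypic la) (coisotypic la).

End SchurWeyl.

Section Tensors.
Variables (R : realType) (k : nat) (n : 'I_k -> nat).

Definition multi_index := {dffun forall i : 'I_k, 'I_(n i)}.

Definition tensor := {ffun multi_index -> R[i]}.

Definition multi_word (m : nat) := {dffun forall i : 'I_k, word (n i) m}.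

(* The coefficient of t^{(x) m}, regrouped leg by leg. *)
Definition tensor_power (t : tensor) (m : nat) (w : multi_word m) : R[i] :=
  \prod_(l < m) t (finfun (fun i : 'I_k => w i l)).

(* (P_{la 1} (x) ... (x) P_{la k}) t^{(x) m}, by its coefficients. *)
Definition isotypic_part (t : tensor) (m : nat) (la : 'I_k -> seq nat) :
    {ffun multi_word m -> R[i]} :=
  [ffun w : multi_word m => \sum_(v : multi_word m) tensor_power t v *
     \prod_i isotypic_proj R[i] (n i) m (la i)
               (enum_rank (v i)) (enum_rank (w i))].

Definition quantum_exponent (theta : 'I_k -> R) (t : tensor) : R :=
  sup [set e : R | exists (m : nat) (la : 'I_k -> seq nat),
    [/\ (0 < m)%N,
        forall j, is_partition m (la j),
        isotypic_part t m la != 0 &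
        e = \sum_j theta j *
              entropy (@normalized_partition R m (la j))]]%classic.

Definition upper_quantum_functional (theta : 'I_k -> R) (t : tensor) : R :=
  if t == 0 then 0 else 2 `^ quantum_exponent theta t.

(* The rows of C i are the vectors of the i-th basis. *)
Definition is_bases (C : forall i : 'I_k, 'M[R[i]]_(n i)) : Prop :=
  forall i, C i \in unitmx.

(* c is the family of coefficients of t in the basis of all
   v_{1,a_1} (x) ... (x) v_{k,a_k}. *)
Definition is_coordinates (C : forall i : 'I_k, 'M[R[i]]_(n i))
    (t c : tensor) : Prop :=
  forall b : multi_index,
    t b = \sum_(a : multi_index) c a * \prod_i C i (a i) (b i).

Definition tensor_supp (c : tensor) : {set multi_index} :=
  [set a | c a != 0].

Definition marginal (P : multi_index -> R) (i : 'I_k) (x : 'I_(n i)) : R :=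
  \sum_(a : multi_index | a i == x) P a.

Definition is_dist_on (S : {set multi_index}) (P : multi_index -> R) : Prop :=
  is_dist P /\ forall a, a \notin S -> P a = 0.

Definition max_support_entropy (theta : 'I_k -> R) (S : {set multi_index}) :
    R :=
  sup [set h : R | exists2 P : multi_index -> R, is_dist_on S P &
    h = \sum_i theta i * entropy (@marginal P i)]%classic.

(* inf and sup are attained for t != 0: there are finitely many supports, and
   the entropy is continuous on the compact set of distributions on one. *)
Definition support_exponent (theta : 'I_k -> R) (t : tensor) : R :=
  inf [set r : R | exists (C : forall i : 'I_k, 'M[R[i]]_(n i)) (c : tensor),
    [/\ is_bases C, is_coordinates C t c &
        r = max_support_entropy theta (tensor_supp c)]]%classic.

Definition upper_support_functional (theta : 'I_k -> R) (t : tensor) : R :=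
  if t == 0 then 0 else 2 `^ support_exponent theta t.

End Tensors.

(* Main.v *)
(** If the support functional is maximal, then for every tuple of bases the support
of t carries a distribution with uniform marginals. By AM-GM and compactness of
the unitary groups, the norm of g t is then bounded below by a positive constant
over all g of determinant one, so some g brings this norm close to its infimum.
For s = g t no direction of any leg can carry noticeably more than its fair share
of the norm, since scaling this direction down would reduce the norm; hence every
reduced density matrix of s is at most (1 + delta) / n_j times the squared norm.

Therefore the part of s^{(x) m} lying, on some leg, in a subspace of dimension
2^(m (log n_j - eps)) is exponentially small. The isotypic components of
partitions of entropy below log n_j - eps lie in such a subspace, which is also
stable under g: it is spanned by the images of the row symmetrizers of the words
of low entropy, and there are few of these by the method of types. So an isotypic
part of t with entropies above log n_j - eps survives, and the quantum functional
is maximal as well.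

That every irreducible representation of S_m is a Specht module is proved with
the sum of all transpositions: a row symmetrizer and a column symmetrizer that are
extremal and do not vanish on an irreducible representation are both eigenvectors
of it, and equating the two eigenvalues forces rows and columns to form a Young
diagram. *)

Require Import Defs.
From HB Require Import structures.
From mathcomp Require Import boolp classical_sets reals sequences exp topology normedtype derive.
From mathcomp Require Import all_boot all_order all_algebra all_fingroup.
From mathcomp Require Import all_solvable.
From mathcomp Require Import mxrepresentation complex sesquilinear spectral.
From mathcomp Require Import zify ring lra.

Set Implicit Arguments.
Unset Strict Implicit.
Unset Printing Implicit Defensive.

Import Order.TTheory GRing.Theory Num.Theory.
Import numFieldNormedType.Exports.

(** * Fillings and Young diagrams *)

(** The balance estimate concerns [g t], while the conclusion concerns [t], and [g] is not unitary:
    it respects isotypic components but not orthogonality. So the orthogonal projector onto the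
    low-entropy subspace is applied only after [g] has acted, and stability under [g] carries the
    vanishing of isotypic parts of [t] across. Symmetrizer images span this subspace because
    counting words then bounds its rank.

    In the compactness argument the obstacle is that the support of [t] jumps with the basis, and
    that the distribution [P] on it has no continuous choice. AM-GM is therefore weakened to the
    product of [min 1 |c_a|^2] over the support, in which [P] no longer occurs; summing these
    products over all supports that carry a uniform point gives a continuous, everywhere positive
    function of the unitary tuple.

    The infimum of the norm is not assumed to be attained, which is why balance holds only up to
    [1 + delta]. The [m]-th power of this factor consumes half of the entropy margin [eps]; the
    other half beats the polynomial factors. *)

Section Fillings.
Variable m : nat.
Implicit Types r c : 'I_m -> nat.

(** This is the sum of the squares of the row lengths: pairs are ordered and the diagonal is
    included. *)
Definition collisions r := \sum_x \sum_(y < m) (r y == r x).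

Definition jointly_injective r c := forall x y, r x = r y -> c x = c y -> x = y.

Definition row_rank r c x := \sum_(y < m) ((r y == r x) && (c y < c x)).

Lemma jointly_injectiveC r c : jointly_injective r c -> jointly_injective c r.
Proof. by move=> inj x y cxy rxy; apply: inj. Qed.

(** Off the diagonal, two entries of one row lie left or right of each other, and both orders occur
    equally often. *)
Lemma collisions_row_rank r c : jointly_injective r c ->
  collisions r = m + (\sum_x row_rank r c x).*2.
Proof.
move=> inj.
have -> : collisions r =
    \sum_x \sum_(y < m) ((y == x) + ((r y == r x) && (c y < c x))
       + ((r y == r x) && (c x < c y))).
  apply: eq_bigr => x _; apply: eq_bigr => y _.
  have [->|nyx] := eqVneq y x; first by rewrite !eqxx ltnn.
  case: eqP => //= e; case: ltngtP => // ec.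
  by case/eqP: nyx; apply: inj.
under eq_bigr do rewrite !big_split /=.
rewrite !big_split /= -addnn addnA; congr (_ + _ + _).
  rewrite -[RHS]card_ord -sum1_card; apply: eq_bigr => x _.
  by rewrite (bigD1 x) //= eqxx big1 // => y /negPf->.
rewrite exchange_big; apply: eq_bigr => x _; apply: eq_bigr => y _.
by rewrite eq_sym.
Qed.

Lemma row_rankE r c x :
  row_rank r c x = #|[pred y : 'I_m | (r y == r x) && (c y < c x)]|.
Proof. by rewrite -sum1_card big_mkcond. Qed.

Lemma row_rank_le r c x : jointly_injective r c -> row_rank r c x <= c x.
Proof.
move=> inj; rewrite row_rankE cardE.
set s := enum _; rewrite -(size_map c) -[leqRHS](size_iota 0).
apply: (uniq_leq_size (s2 := iota 0 (c x))).
  rewrite map_inj_in_uniq ?enum_uniq // => y z.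
  rewrite !mem_enum !inE => /andP[/eqP ry _] /andP[/eqP rz _] /inj; apply.
  by rewrite ry rz.
move=> j /mapP[y]; rewrite mem_enum inE => /andP[_ lt] ->.
by rewrite mem_iota.
Qed.

Lemma row_rank_full r c x : jointly_injective r c -> row_rank r c x = c x ->
  forall j, j < c x -> exists2 y, r y = r x & c y = j.
Proof.
move=> inj full j ltj; apply: contrapT => none.
have: row_rank r c x < c x; last by rewrite full ltnn.
rewrite row_rankE cardE; set s := enum _.
have: uniq (j :: map c s).
  rewrite /= map_inj_in_uniq ?enum_uniq ?andbT => [|y z].
    apply/mapP => -[y]; rewrite mem_enum inE => /andP[/eqP ry _] jE.
    by apply: none; exists y.
  rewrite !mem_enum !inE => /andP[/eqP ry _] /andP[/eqP rz _] /inj; apply.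
  by rewrite ry rz.
move=> us; have := uniq_leq_size (s2 := iota 0 (c x)) us.
rewrite /= size_map size_iota; apply.
move=> i; rewrite inE mem_iota => /orP[/eqP->//|/mapP[y]].
by rewrite mem_enum inE => /andP[_ lt] ->.
Qed.

Lemma row_rank_tight r c : jointly_injective r c ->
  \sum_x c x <= \sum_x row_rank r c x -> forall x, row_rank r c x = c x.
Proof.
move=> inj le x; apply/eqP; rewrite eqn_leq row_rank_le //=.
rewrite leqNgt; apply/negP => lt; move: le; apply/negP; rewrite -ltnNge.
rewrite (bigD1 x) //= [ltnRHS](bigD1 x) //= -addSn leq_add //.
by apply: leq_sum => i _; apply: row_rank_le.
Qed.

Lemma row_fill r c : jointly_injective r c ->
    (forall x, row_rank r c x = c x) ->
  forall i j, j < #|[pred x | r x == i]| -> exists2 x, r x = i & c x = j.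
Proof.
move=> inj full i j ltj; apply: contrapT => none.
have: #|[pred x | r x == i]| <= j; last by rewrite leqNgt ltj.
rewrite cardE -(size_map c) -[leqRHS](size_iota 0).
apply: (uniq_leq_size (s2 := iota 0 j)).
  rewrite map_inj_in_uniq ?enum_uniq // => y z.
  by rewrite !mem_enum !inE => /eqP ry /eqP rz /inj; apply; rewrite ry rz.
move=> h /mapP[y]; rewrite mem_enum inE => /eqP ry ->; rewrite mem_iota /=.
rewrite add0n ltnNge; apply/negP; rewrite leq_eqVlt => /orP[/eqP jE|lt].
  by apply: none; exists y.
have [z rz cz] := row_rank_full inj (full y) lt.
by apply: none; exists z; rewrite // rz.
Qed.

Lemma filling_transport r c r' c' : jointly_injective r' c' ->
    (forall e, exists2 x, r x = r' e & c x = c' e) ->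
  exists h : 'S_m, forall e, r (h e) = r' e /\ c (h e) = c' e.
Proof.
move=> inj ex.
have ex' e : exists x, (r x == r' e) && (c x == c' e).
  by have [x rx cx] := ex e; exists x; rewrite rx cx !eqxx.
have hinj : injective (fun e => xchoose (ex' e)).
  move=> e f ef; have := xchooseP (ex' e); rewrite ef.
  have /andP[/eqP-> /eqP->] := xchooseP (ex' f).
  by case/andP=> /eqP re /eqP ce; apply: inj.
exists (perm hinj) => e; rewrite permE.
by have /andP[/eqP-> /eqP->] := xchooseP (ex' e).
Qed.

End Fillings.

Section Tableau.
Variables (m : nat) (la : seq nat).
Hypothesis la_m : sumn la = m.

Definition tab_row (e : 'I_m) : nat := reshape_index la e.
Definition tab_col (e : 'I_m) : nat := reshape_offset la e.

Lemma tab_row_lt e : tab_row e < size la.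
Proof. by apply: reshape_indexP; rewrite la_m. Qed.

Lemma tab_col_lt e : tab_col e < nth 0 la (tab_row e).
Proof. by apply: reshape_offsetP; rewrite la_m. Qed.

Lemma tab_inj : jointly_injective tab_row tab_col.
Proof.
move=> x y rxy cxy; apply: val_inj => /=.
rewrite -(reshape_indexK la x) -(reshape_indexK la y).
by rewrite -/(tab_row x) -/(tab_col x) rxy cxy.
Qed.

Lemma tab_cell i j : j < nth 0 la i -> exists2 e, tab_row e = i & tab_col e = j.
Proof.
move=> lt; have := flatten_indexP lt; rewrite la_m => ltm.
by exists (Ordinal ltm); [apply: flatten_indexKl|apply: flatten_indexKr].
Qed.

Lemma tab_row_card i : #|[pred x | tab_row x == i]| = nth 0 la i.
Proof.
apply/eqP; rewrite eqn_leq; apply/andP; split; rewrite cardE.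
  rewrite -(size_map tab_col) -[leqRHS](size_iota 0).
  apply: (uniq_leq_size (s2 := iota 0 (nth 0 la i))).
    rewrite map_inj_in_uniq ?enum_uniq // => y z.
    by rewrite !mem_enum !inE => /eqP ry /eqP rz /tab_inj; apply; rewrite ry rz.
  move=> h /mapP[y]; rewrite mem_enum inE => /eqP ry ->.
  by rewrite mem_iota -ry tab_col_lt.
rewrite -(size_map tab_col) -[leqLHS](size_iota 0).
apply: (uniq_leq_size (s2 := map tab_col _)); first exact: iota_uniq.
move=> j; rewrite mem_iota add0n => /= lt; have [e re <-] := tab_cell lt.
by apply: map_f; rewrite mem_enum inE re.
Qed.

Lemma tab_row_rank e : row_rank tab_row tab_col e = tab_col e.
Proof.
apply/eqP; rewrite eqn_leq row_rank_le; last exact: tab_inj.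
rewrite row_rankE cardE -[leqLHS](size_iota 0) -(size_map tab_col).
apply: (uniq_leq_size (s2 := map tab_col _)); first exact: iota_uniq.
move=> j; rewrite mem_iota add0n => /= lt.
have [f re cf] := tab_cell (ltn_trans lt (tab_col_lt e)).
by rewrite -cf; apply: map_f; rewrite mem_enum inE re cf eqxx.
Qed.

(** The number of collisions fixes the sum of the row ranks, so [tab_col] has the least possible sum
    among fillings injective on rows. A filling that reaches it has no gaps in any row and differs
    from the tableau by a permutation inside the rows. *)
Lemma tab_row_stab (c : 'I_m -> nat) : jointly_injective tab_row c ->
    \sum_x c x <= \sum_x tab_col x ->
  exists h : 'S_m, forall e, tab_row (h e) = tab_row e /\ c (h e) = tab_col e.
Proof.
move=> inj le; apply: filling_transport; first exact: tab_inj.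
have full : forall x, row_rank tab_row c x = c x.
  apply: row_rank_tight => //.
  have := collisions_row_rank inj; rewrite (collisions_row_rank tab_inj).
  under [in X in X = _]eq_bigr do rewrite tab_row_rank.
  lia.
by move=> e; apply: row_fill => //; rewrite tab_row_card tab_col_lt.
Qed.

End Tableau.

Lemma nth_filter_gt0 s i : sorted geq s -> nth 0 [seq x <- s | 0 < x] i = nth 0 s i.
Proof.
elim: s i => //= a s IH i ps.
have ss := path_sorted ps.
case: a ps => [|a] ps /=; last by case: i => //= i; rewrite IH.
have -> : s = nseq (size s) 0.
  apply/all_pred1P; apply/allP => x xs.
  have := order_path_min (rev_trans leq_trans) ps => /allP /(_ x xs) /=.
  by rewrite leqn0.
by rewrite filter_nseq nth_nil -[0 :: _]/(nseq (size s).+1 0) nth_nseq if_same.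
Qed.

Lemma col_lt_card m (r c : 'I_m -> nat) x :
  row_rank r c x = c x -> c x < #|[pred y | r y == r x]|.
Proof.
rewrite row_rankE => <-; apply: proper_card; apply/properP; split.
  by apply/subsetP => y; rewrite !inE => /andP[].
by exists x; rewrite !inE ?eqxx ?ltnn.
Qed.

Lemma sumn_filter_gt0 s : sumn [seq x <- s | 0 < x] = sumn s.
Proof. by elim: s => //= -[|a] s IH //=; rewrite IH. Qed.

(** By [collisions_row_rank] the equation says that [row_rank r c x <= c x] and
    [row_rank c r x <= r x] become equalities after summation, hence for every [x]: no cell has a
    gap to its left or above it, so the cells form a Young diagram. *)
Lemma filling_tableau m (r c : 'I_m -> nat) : jointly_injective r c ->
    collisions r + collisions c = (m + \sum_x r x + \sum_x c x).*2 ->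
  exists2 la, is_partition m la & exists h : 'S_m, forall e,
    r (h e) = tab_row la e /\ c (h e) = tab_col la e.
Proof.
move=> inj; have inj' := jointly_injectiveC inj.
rewrite (collisions_row_rank inj) (collisions_row_rank inj') => eqs.
have le1 : \sum_x row_rank r c x <= \sum_x c x.
  by apply: leq_sum => i _; apply: row_rank_le.
have le2 : \sum_x row_rank c r x <= \sum_x r x.
  by apply: leq_sum => i _; apply: row_rank_le.
have [le1' le2'] : \sum_x c x <= \sum_x row_rank r c x /\
    \sum_x r x <= \sum_x row_rank c r x.
  move: eqs le1 le2; move: (\sum_x c x) (\sum_x r x) (\sum_x row_rank r c x).
  by move: (\sum_x row_rank c r x) => *; lia.
have fc : forall x, row_rank r c x = c x by apply: row_rank_tight.
have fr : forall x, row_rank c r x = r x by apply: row_rank_tight.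
pose F i := #|[pred x | r x == i]|.
(* If row [i.+1] were longer, its cell in column [F i] would have a cell above it, lying in row [i]
   at a column beyond the end of that row. *)
have Fdec i : F i.+1 <= F i.
  rewrite leqNgt; apply/negP => lt.
  have [x rx cx] := row_fill inj fc lt.
  have [|y cy ry] := row_rank_full inj' (fr x) (j := i); first by rewrite rx.
  have := col_lt_card (fc y); rewrite cy cx -/(F _) ry => h.
  by rewrite -/(F _) ltnn in h.
have rm x : r x < m.
  by apply: leq_trans (col_lt_card (fr x)) _; rewrite -[leqRHS]card_ord max_card.
pose s := mkseq F m.
have ss : sorted geq s.
  apply/(sortedP 0) => i; rewrite size_mkseq => lt; rewrite !nth_mkseq ?(ltnW lt) //; exact: Fdec.
have sF i : nth 0 s i = F i.
  case: (ltnP i m) => le; first by rewrite nth_mkseq.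
  rewrite nth_default ?size_mkseq //; apply/esym/eq_card0 => x; rewrite inE.
  by apply/eqP => xE; move: (rm x); rewrite xE ltnNge le.
pose la := [seq x <- s | 0 < x].
have laF i : nth 0 la i = F i by rewrite nth_filter_gt0.
have lam : sumn la = m.
  rewrite sumn_filter_gt0 sumnE big_map -[RHS]card_ord -sum1_card.
  rewrite (partition_big (fun x => Ordinal (rm x)) xpredT) //= -val_enum_ord.
  rewrite big_map big_enum; apply: eq_bigr => i _.
  by rewrite /F -sum1_card; apply: eq_bigl => x; rewrite inE -val_eqE.
exists la.
  apply/and3P; split; last by rewrite lam.
    by apply: sorted_filter => //; apply: rev_trans; apply: leq_trans.
  by rewrite mem_filter.
apply: filling_transport; first exact: tab_inj.
by move=> e; apply: row_fill => //; have := tab_col_lt lam e; rewrite laF.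
Qed.

Local Open Scope ring_scope.
(** * Symmetrizers and irreducible representations of S_m *)

Section SymmetricGroupOperators.
Variables (C : numFieldType) (m : nat).
Implicit Types (r c : 'I_m -> nat) (s g h : 'S_m).

Definition stabilizes r s := [forall x, r (s x) == r x].

Lemma stabilizesP r s : reflect (forall x, r (s x) = r x) (stabilizes r s).
Proof. by apply: (iffP forallP) => H x; apply/eqP/H. Qed.

Lemma stabilizesM r s g : stabilizes r s -> stabilizes r (s * g)%g = stabilizes r g.
Proof.
move/stabilizesP=> rs; apply/stabilizesP/stabilizesP => H x.
  by rewrite -{1}(permKV s x) -permM H -rs permKV.
by rewrite permM H rs.
Qed.

Lemma stabilizesV r s : stabilizes r s^-1%g = stabilizes r s.
Proof.
apply/stabilizesP/stabilizesP => H x; first by rewrite -[in RHS](permK s x) H.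
by rewrite -[in RHS](permKV s x) H.
Qed.

Lemma stabilizesMr r s g : stabilizes r s -> stabilizes r (g * s)%g = stabilizes r g.
Proof. by move=> rs; rewrite -stabilizesV invMg stabilizesM ?stabilizesV. Qed.

Lemma stabilizes_tperm r x y : r x = r y -> stabilizes r (tperm x y).
Proof. by move=> e; apply/stabilizesP => z; case: tpermP => [->|->|]. Qed.

Lemma eq_stabilizes r r' : r =1 r' -> stabilizes r =1 stabilizes r'.
Proof. by move=> e s; apply: eq_forallb => x; rewrite !e. Qed.

Variables (d : nat).
Implicit Type rG : mx_representation C [set: 'S_m] d.

Definition row_sum rG r : 'M[C]_d := \sum_(s | stabilizes r s) rG s.
Definition col_sum rG c : 'M[C]_d :=
  \sum_(s | stabilizes c s) (-1) ^+ odd_perm s *: rG s.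

Lemma repr_SmM rG s g : rG (s * g)%g = rG s *m rG g.
Proof. by rewrite repr_mxM ?in_setT. Qed.

(** Twisting by the sign turns column antisymmetrizers into row symmetrizers, so facts about the
    former follow from those about the latter. *)
Lemma sgn_mx_repr rG :
  mx_repr [set: 'S_m] (fun s => (-1) ^+ odd_perm s *: rG s).
Proof.
split=> [|s g _ _]; first by rewrite odd_perm1 expr0 scale1r repr_mx1.
by rewrite odd_permM signr_addb repr_SmM -scalemxAl -scalemxAr scalerA.
Qed.
Definition sgn_repr rG := MxRepresentation (sgn_mx_repr rG).

Lemma row_sum_sgn rG r : row_sum (sgn_repr rG) r = col_sum rG r.
Proof. by []. Qed.

Lemma eq_row_sum rG r r' : stabilizes r =1 stabilizes r' -> row_sum rG r = row_sum rG r'.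
Proof. by move=> e; apply: eq_bigl. Qed.

Lemma row_sumJ rG r g : row_sum rG (r \o g) *m rG g = rG g *m row_sum rG r.
Proof.
rewrite mulmx_suml mulmx_sumr.
rewrite (reindex_inj (inj_comp (mulgI g) (mulIg g^-1%g))) /=.
apply: eq_big => [s|s _].
  apply/stabilizesP/stabilizesP => H x /=.
    by have /= := H (g^-1%g x); rewrite !permM !permKV.
  by rewrite !permM permKV H.
by rewrite -!repr_SmM !mulgA mulgKV.
Qed.

Lemma col_sumJ rG r g : col_sum rG (r \o g) *m rG g = rG g *m col_sum rG r.
Proof.
have := row_sumJ (sgn_repr rG) r g; rewrite !row_sum_sgn /= -scalemxAl -scalemxAr.
by move/(congr1 ( *:%R ((-1) ^+ odd_perm g))); rewrite !scalerA -signr_addb addbb !scale1r.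
Qed.

Lemma row_sumMl rG r s : stabilizes r s -> rG s *m row_sum rG r = row_sum rG r.
Proof.
move=> rs; rewrite mulmx_sumr [RHS](reindex_inj (mulgI s)) /=.
by apply: eq_big => [g|g _]; rewrite ?(stabilizesM _ rs) ?repr_SmM.
Qed.

Lemma row_sumMr rG r s : stabilizes r s -> row_sum rG r *m rG s = row_sum rG r.
Proof.
move=> rs; rewrite mulmx_suml [RHS](reindex_inj (mulIg s)) /=.
by apply: eq_big => [g|g _]; rewrite ?(stabilizesMr _ rs) ?repr_SmM.
Qed.

Lemma col_sumMl rG r s : stabilizes r s ->
  rG s *m col_sum rG r = (-1) ^+ odd_perm s *: col_sum rG r.
Proof.
move/(row_sumMl (sgn_repr rG)); rewrite row_sum_sgn /= -scalemxAl => e.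
by rewrite -[in RHS]e scalerA -signr_addb addbb scale1r.
Qed.

(** A transposition of two entries sharing a row and a column is absorbed by the row factor with
    sign [+1] and by the column factor with sign [-1]. *)
Lemma row_col_sum_inj rG r c g :
  row_sum rG r *m rG g *m col_sum rG c != 0 -> jointly_injective r (c \o g).
Proof.
move=> nz x y rxy cxy; apply/eqP; apply: contraNT nz => nxy.
rewrite -mulmxA -col_sumJ mulmxA.
set P := row_sum rG r *m _; suff: P = - P.
  by move/eqP; rewrite -addr_eq0 -mulr2n -scaler_nat scaler_eq0 pnatr_eq0 => /eqP->; rewrite mul0mx.
rewrite /P -{1}(row_sumMr rG (stabilizes_tperm rxy)) -mulmxA.
by rewrite col_sumMl ?stabilizes_tperm // odd_tperm nxy expr1 scaleN1r mulmxN.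
Qed.

(** The pairs are ordered and include [x = y], so this is [m] plus twice the class sum of the
    transpositions. *)
Definition transp_sum rG : 'M[C]_d := \sum_x \sum_y rG (tperm x y).

Lemma transp_sumC rG g : transp_sum rG *m rG g = rG g *m transp_sum rG.
Proof.
rewrite mulmx_suml mulmx_sumr (reindex_inj (@perm_inj _ g^-1%g)) /=.
apply: eq_bigr => x _; rewrite mulmx_suml mulmx_sumr.
rewrite (reindex_inj (@perm_inj _ g^-1%g)) /=; apply: eq_bigr => y _.
rewrite -!repr_SmM; congr (rG _).
have := tpermJ x y g^-1%g.
by rewrite conjgE invgK => <-; rewrite -!mulgA mulVg mulg1.
Qed.

Lemma transp_sum_col_sumC rG r : transp_sum rG *m col_sum rG r = col_sum rG r *m transp_sum rG.
Proof.
rewrite [in LHS]mulmx_sumr [in RHS]mulmx_suml; apply: eq_bigr => s _.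
by rewrite -scalemxAl -scalemxAr transp_sumC.
Qed.

(* Moving x into fiber i multiplies the symmetrizer, up to the part fixing x, by
   the sum of the transpositions (x y). *)
Lemma row_sum_move rG r x i : r x != i ->
    row_sum rG (fun y => if y == x then i else r y) = 0 ->
  \sum_(y | r y == i) row_sum rG r *m rG (tperm x y) = - row_sum rG r.
Proof.
move=> rxi; set r' := fun y => _ => A'0.
pose H := \sum_(s | stabilizes r s && (s x == x)) rG s.
have HE s : stabilizes r s && (s x == x) = stabilizes r' s && (s x == x).
  have [sx|] := eqVneq (s x) x; rewrite ?andbF // !andbT.
  apply/stabilizesP/stabilizesP => S y; have := S y; rewrite /r'.
    by rewrite -{1}sx (inj_eq perm_inj); case: eqP.
  by rewrite -{1}sx (inj_eq perm_inj); case: eqP => // ->; rewrite sx.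
have AH : row_sum rG r *m H = #|[pred s | stabilizes r s && (s x == x)]|%:R *: row_sum rG r.
  rewrite mulmx_sumr -sum1_card natr_sum scaler_suml; apply: eq_bigr => s /andP[rs _].
  by rewrite row_sumMr // scale1r.
have A'E : row_sum rG r' = \sum_(y | r' y == i) H *m rG (tperm x y).
  rewrite /row_sum (partition_big (fun s => s x) (fun y => r' y == i)) => [|s /stabilizesP ->]; last first.
    by rewrite /r' eqxx.
  apply: eq_bigr => y /eqP ry.
  rewrite mulmx_suml (reindex_inj (mulIg (tperm x y))) /=.
  have r'xy : stabilizes r' (tperm x y).
    by apply: stabilizes_tperm; rewrite ry /r' eqxx.
  apply: eq_big => [s|s _]; last by rewrite repr_SmM.
  rewrite stabilizesMr // HE permM; congr (_ && _).
  by rewrite -[X in _ == X](tpermL x y) (inj_eq perm_inj).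
have : row_sum rG r *m row_sum rG r' = 0 by rewrite A'0 mulmx0.
rewrite A'E mulmx_sumr.
under eq_bigr do rewrite mulmxA AH -scalemxAl.
rewrite -scaler_sumr => /eqP; rewrite scaler_eq0 pnatr_eq0 => /orP[/eqP/card0_eq/(_ 1%g)|].
  by rewrite !inE perm1 eqxx andbT => /negP[]; apply/stabilizesP => y; rewrite perm1.
rewrite (bigD1 x) /=; last by rewrite /r' eqxx.
rewrite tperm1 repr_mx1 mulmx1 addr_eq0 => /eqP e; rewrite [in RHS]e opprK.
apply: eq_bigl => y; rewrite /r'; have [->|] := eqVneq y x; last by rewrite andbT.
by rewrite (negPf rxi) andbF.
Qed.

End SymmetricGroupOperators.

Lemma collisionsD1 m (r : 'I_m -> nat) x :
  collisions r = (1 + (\sum_(y | y != x) (r y == r x)).*2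
    + \sum_(y | y != x) \sum_(z | z != x) (r z == r y))%N.
Proof.
rewrite /collisions (bigD1 x) //= (bigD1 x) //= eqxx -addnn !addnA -!addnA.
congr (_ + (_ + _))%N; rewrite -big_split /=; apply: eq_bigr => y _.
by rewrite (bigD1 x) //= eq_sym.
Qed.

(** Moving an entry from a row of length [p] to one of length [q >= p] raises the sum of squares by
    [2 * (q - p + 1)]. *)
Lemma collisions_move m (r : 'I_m -> nat) x i : r x != i ->
    (#|[pred y | r y == r x]| <= #|[pred y | r y == i]|)%N ->
  (collisions r < collisions (fun y => if y == x then i else r y))%N.
Proof.
move=> rxi le; rewrite !(collisionsD1 _ x) eqxx.
have -> : (\sum_(y | y != x) \sum_(z | z != x)
    ((if z == x then i else r z) == (if y == x then i else r y)) =
    \sum_(y | y != x) \sum_(z | z != x) (r z == r y))%N.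
  apply: eq_bigr => y /negPf->; apply: eq_bigr => z /negPf->.
  by [].
rewrite ltn_add2r ltn_add2l ltn_double.
have e1 : #|[pred y | r y == r x]| = (1 + \sum_(y | y != x) (r y == r x))%N.
  by rewrite -sum1_card big_mkcond (bigD1 x) //= inE eqxx.
have e2 : #|[pred y | r y == i]| = (\sum_(y | y != x) (r y == i))%N.
  by rewrite -sum1_card big_mkcond (bigD1 x) //= inE (negPf rxi).
have -> : (\sum_(y | y != x) ((if y == x then i else r y) == i) =
    \sum_(y | y != x) (r y == i))%N.
  by apply: eq_bigr => y /negPf->.
by rewrite -e2 (leq_trans _ le) // e1.
Qed.

Section Content.
Variables (C : numFieldType) (m d : nat).
Variable rG : mx_representation C [set: 'S_m] d.

(** Among the fillings with nonzero symmetrizer, [r] maximizes the collisions and then minimizes the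
    sum of the row indices. Moving an entry to an earlier row therefore makes the symmetrizer
    vanish, and [row_sum_move] evaluates the transpositions between distinct rows: each pair of an
    entry [x] and a row [i < r x] contributes [-1], twice. *)
Lemma exists_row_content : (0 < d)%N ->
  exists2 r : 'I_m -> nat, row_sum rG r != 0 &
    row_sum rG r *m transp_sum rG =
      ((collisions r)%:R - (\sum_x r x).*2%:R) *: row_sum rG r.
Proof.
move=> d0.
pose A (f : {ffun 'I_m -> 'I_m}) := row_sum rG (fun x => f x).
pose col (f : {ffun 'I_m -> 'I_m}) := collisions (fun x => f x : nat).
pose sm (f : {ffun 'I_m -> 'I_m}) := (\sum_x f x)%N.
(* Lexicographic order in a single number: the second summand is at most [m * m], so one more
   collision outweighs it. *)
pose key f := (col f * (m * m).+1 + (m * m - sm f))%N.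
have smle f : (sm f <= m * m)%N.
  rewrite -[X in (X * _)%N]card_ord -sum_nat_const; apply: leq_sum => x _.
  exact: ltnW.
pose f0 : {ffun 'I_m -> 'I_m} := [ffun x => x].
have Af0 : A f0 != 0.
  rewrite /A /row_sum (big_pred1 1%g) => [|s].
    rewrite repr_mx1; apply/eqP => e; have := congr1 (fun M : 'M_d => M (Ordinal d0) (Ordinal d0)) e.
    by rewrite !mxE eqxx => /eqP; rewrite oner_eq0.
  rewrite pred1E; apply/stabilizesP/eqP => [H|<- x]; last by rewrite perm1.
  by apply/permP => x; apply/esym; apply: val_inj; have := H x; rewrite !ffunE perm1.

have [f Af fmax] := arg_maxnP (P := fun f => A f != 0) key Af0.
pose F i := #|[pred y | f y == i :> nat]|.
have FE i : F i = (\sum_y (f y == i :> nat))%N.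
  by rewrite /F -sum1_card big_mkcond.
(* Otherwise exchanging the names of rows [i] and [j] keeps the symmetrizer and the collisions but
   lowers the sum of the row indices. *)
have Fsort (i : 'I_m) x : (i < f x)%N -> (F (f x) <= F i)%N.
  move=> ltx; rewrite leqNgt; apply/negP => ltF.
  set j := f x in ltx ltF *.
  pose g : {ffun 'I_m -> 'I_m} := [ffun y => tperm i j (f y)].
  have g_eq y z : (g y == g z :> nat) = (f y == f z :> nat).
    by rewrite !ffunE !(inj_eq (@ord_inj m)) (inj_eq perm_inj).
  have Ag : A g != 0.
    rewrite /A (_ : row_sum _ _ = A f) //; apply: eq_row_sum => s.
    by apply: eq_forallb => y; rewrite g_eq.
  have cg : col g = col f.
    by apply: eq_bigr => y _; apply: eq_bigr => z _; rewrite g_eq.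
  have sg : (sm g + j * F j + i * F i = sm f + i * F j + j * F i)%N.
    rewrite !FE /sm !big_distrr -!big_split /=.
    apply: eq_bigr => y _; rewrite ffunE !val_eqE.
    case: tpermP => [->|->|/eqP/negPf-> /eqP/negPf->]; rewrite ?eqxx.
    - by rewrite -val_eqE ltn_eqF // !muln0 !muln1 !addn0 addnC.
    - by rewrite -val_eqE gtn_eqF // !muln0 !muln1 !addn0 addnC.
    by rewrite !muln0 !addn0.
  have /= := fmax g Ag; rewrite /key cg leq_add2l => le.
  have := smle f; have := smle g.
  have : (sm g < sm f)%N by nia.
  lia.
have Amove i x : (i < f x)%N -> row_sum rG (fun y => if y == x then i else f y : nat) = 0.
  move=> ltx; apply/eqP/negPn/negP => nz.
  have im : (i < m)%N by apply: ltn_trans ltx _.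
  pose g : {ffun 'I_m -> 'I_m} := [ffun y => if y == x then Ordinal im else f y].
  have gE y : (if y == x then i else f y : nat) = g y by rewrite ffunE; case: eqP.
  have Ag : A g != 0.
    by rewrite /A -(eq_row_sum rG (eq_stabilizes gE)).
  have cg : (col f < col g)%N.
    have := @collisions_move m (fun y => f y) x i; rewrite gtn_eqF //.
    move/(_ isT)/(_ (Fsort (Ordinal im) x ltx)); congr (_ < _)%N.
    by apply: eq_bigr => y _; apply: eq_bigr => z _; rewrite !gE.
  have /= := fmax g Ag; rewrite /key.
  have := smle f; have := smle g; nia.
exists (fun x => f x : nat) => //; rewrite -/(A f).
(* Exchanging [x] and [y] identifies the pairs with [f x < f y] and those with [f y < f x], whence
   two copies of [L] beside the pairs in a common row. *)
pose L := \sum_x \sum_(y | (f y < f x)%N) A f *m rG (tperm x y).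
have -> : A f *m transp_sum rG = (col f)%:R *: A f + L + L.
  rewrite {2}/L (exchange_big_dep xpredT) //= [RHS]addrAC.
  rewrite mulmx_sumr /col /collisions natr_sum scaler_suml -!big_split /=.
  apply: eq_bigr => x _.
  rewrite mulmx_sumr natr_sum scaler_suml.
  rewrite (bigID (fun y => f y == f x)) /= -addrA; congr (_ + _).
    rewrite big_mkcond; apply: eq_bigr => y _ /=.
    rewrite -val_eqE /=; case: eqP => e; last by rewrite scale0r.
    by rewrite row_sumMr ?scale1r //; apply: stabilizes_tperm.
  rewrite (bigID (fun y => f y < f x)%N) /= addrC; congr (_ + _).
    apply: eq_big => [y|y _]; last by rewrite tpermC.
    by rewrite -val_eqE /=; case: ltngtP.
  apply: eq_bigl => y.
  by rewrite -val_eqE /=; case: ltngtP.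
have -> : L = - (\sum_x f x)%:R *: A f.
  rewrite /L natr_sum -sumrN scaler_suml; apply: eq_bigr => x _.
  rewrite (partition_big f (fun i : 'I_m => (i < f x)%N)) //=.
  have -> : \sum_(i < m | (i < f x)%N) \sum_(y | (f y < f x)%N && (f y == i)) A f *m rG (tperm x y)
     = \sum_(i < m | (i < f x)%N) - A f.
    apply: eq_bigr => i ltx.
    rewrite -(@row_sum_move _ _ _ rG (fun y => f y) x i) ?gtn_eqF //; last exact: Amove.
    apply: eq_bigl => y; rewrite -val_eqE /=.
    by case: eqP => [->|]; rewrite ?ltx ?andbF.
  rewrite -(big_ord_widen m (fun _ => - A f) (ltnW (ltn_ord (f x)))).
  by rewrite sumr_const card_ord mulNrn -scaler_nat scaleNr.
by rewrite -addnn natrD opprD addrA !scalerDl.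
Qed.

End Content.

Local Open Scope sesquilinear_scope.
Lemma mulmx_lin_comb (F : comPzRingType) n1 n2 n3 n4 (I : finType) (P : pred I)
    (z : I -> F) (A : 'M_(n1, n2)) (B : 'M_(n3, n4)) (M : I -> 'M_(n2, n3)) :
  A *m (\sum_(i | P i) z i *: M i) *m B = \sum_(i | P i) z i *: (A *m M i *m B).
Proof.
rewrite mulmx_sumr mulmx_suml; apply: eq_bigr => i _.
by rewrite -scalemxAr -scalemxAl.
Qed.

Section YoungElements.
Variables (C : numFieldType) (m : nat).

Definition young d (rG : mx_representation C [set: 'S_m] d) (la : seq nat) : 'M[C]_d :=
  row_sum rG (tab_row la) *m col_sum rG (tab_col la).

Section Intertwine.
Variables (d1 d2 : nat) (rG1 : mx_representation C [set: 'S_m] d1).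
Variables (rG2 : mx_representation C [set: 'S_m] d2) (B : 'M[C]_(d1, d2)).
Hypothesis homB : forall s, rG1 s *m B = B *m rG2 s.

Lemma row_sum_hom r : row_sum rG1 r *m B = B *m row_sum rG2 r.
Proof. by rewrite mulmx_suml mulmx_sumr; apply: eq_bigr => s _; rewrite homB. Qed.

Lemma col_sum_hom r : col_sum rG1 r *m B = B *m col_sum rG2 r.
Proof.
rewrite mulmx_suml mulmx_sumr; apply: eq_bigr => s _.
by rewrite -scalemxAl homB scalemxAr.
Qed.

Lemma young_hom la : young rG1 la *m B = B *m young rG2 la.
Proof. by rewrite -mulmxA col_sum_hom mulmxA row_sum_hom mulmxA. Qed.
End Intertwine.

Section OneRepresentation.
Variables (d : nat) (rG : mx_representation C [set: 'S_m] d).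

(** A nonzero row of [A] generates the whole module, so [B] cannot kill all its translates. *)
Lemma irr_connect (A B : 'M[C]_d) : mx_irreducible rG -> A != 0 -> B != 0 ->
  exists g, A *m rG g *m B != 0.
Proof.
move=> /mx_irrP[_ irr] A0 B0; apply: contrapT => none.
case/eqP: B0; apply/row_matrixP => i; rewrite row0 rowE.
have u0 : nz_row A != 0 by rewrite nz_row_eq0.
have full := irr _ (cyclic_mx_module rG (nz_row A)).
rewrite cyclic_mx_eq0 in full.
have /cyclic_mxP[M /envelop_mxP[a ->] ->] : ((delta_mx 0 i : 'rV_d) <= cyclic_mx rG (nz_row A))%MS.
  by apply: submx_full; apply: full.
rewrite mulmx_sumr mulmx_suml big1 // => g _.
have /submxP[D ->] := nz_row_sub A.
rewrite -scalemxAr -scalemxAl -!mulmxA (mulmxA A).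
case: (eqVneq (A *m rG g *m B) 0) => [->|nz]; first by rewrite mulmx0 scaler0.
by case: none; exists g.
Qed.

Lemma repr_unit g : rG g \in unitmx.
Proof. by rewrite repr_mx_unit ?in_setT. Qed.

(** The diagonal pairs contribute [m] to both sums, and every other pair changes sign. *)
Lemma transp_sum_sgn : transp_sum (sgn_repr rG) = m.*2%:R%:M - transp_sum rG.
Proof.
rewrite -muln2 -[X in (X * _)%N]card_ord -sum_nat_const natr_sum.
rewrite raddf_sum /= -sumrB; apply: eq_bigr => x _.
rewrite [in LHS](bigD1 x) //= [in RHS](bigD1 x) //= tperm1 odd_perm1 repr_mx1 expr0 scale1r.
rewrite opprD addrA; congr (_ + _).
  by rewrite -[2%:R]/(1 + 1) raddfD /= addrK.
rewrite -sumrN; apply: eq_bigr => y nyx.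
by rewrite odd_tperm eq_sym nyx expr1 scaleN1r.
Qed.

Lemma irr_young : mx_irreducible rG ->
  exists2 la, is_partition m la & young rG la != 0.
Proof.
move=> irr; have d0 : (0 < d)%N by case/mx_irrP: irr.
have [r A0 AT] := exists_row_content rG d0.
have [c B0 BT] := exists_row_content (sgn_repr rG) d0.
rewrite row_sum_sgn in B0 BT.
have [g nz] := irr_connect irr A0 B0.
have inj := row_col_sum_inj nz.
have ccg : collisions (c \o g) = collisions c.
  rewrite /collisions [RHS](reindex_inj (@perm_inj _ g)); apply: eq_bigr => x _.
  by rewrite [RHS](reindex_inj (@perm_inj _ g)).
have scg : (\sum_x (c \o g) x = \sum_x c x)%N.
  by rewrite [RHS](reindex_inj (@perm_inj _ g)).
have eqs : (collisions r + collisions (c \o g) =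
    (m + \sum_x r x + \sum_x (c \o g) x).*2)%N.
  rewrite ccg scg.
  have e1 : row_sum rG r *m rG g *m (transp_sum rG *m col_sum rG c) =
      ((collisions r)%:R - (\sum_x r x).*2%:R) *: (row_sum rG r *m rG g *m col_sum rG c).
    by rewrite mulmxA -(mulmxA _ (rG g)) -transp_sumC mulmxA AT -!scalemxAl.
  rewrite transp_sum_col_sumC in e1.
  rewrite transp_sum_sgn mulmxBr mul_mx_scalar in BT.
  have {}BT : col_sum rG c *m transp_sum rG = (m.*2%:R -
    ((collisions c)%:R - (\sum_x c x).*2%:R)) *: col_sum rG c.
    by rewrite scalerBl -BT opprB addrC subrK.
  rewrite BT -scalemxAr in e1; move/eqP: e1; rewrite -subr_eq0 -scalerBl scaler_eq0.
  rewrite (negPf nz) orbF => /eqP e.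
  apply/eqP; rewrite -(eqr_nat C) !doubleD !natrD -subr_eq0 -oppr_eq0 -[X in _ == X]e.
  by apply/eqP; ring.
(* Conjugation by [h] turns [r] and [c \o g] into the rows and columns of the tableau, so the
   nonzero product is the Young element up to invertible factors. *)
have [la lam [h hE]] := filling_tableau inj eqs.
exists la => //; apply: contraNneq nz => y0.
have er : row_sum rG (tab_row la) *m rG h = rG h *m row_sum rG r.
  by rewrite -row_sumJ; congr (_ *m _); apply/eq_row_sum/eq_stabilizes => e /=; case: (hE e).
have ec : col_sum rG (tab_col la) *m rG (h * g)%g = rG (h * g)%g *m col_sum rG c.
  rewrite -col_sumJ; congr (_ *m _); apply: eq_bigl; apply: eq_stabilizes => e /=.
  by rewrite permM; case: (hE e).
have : rG h *m (row_sum rG r *m rG g *m col_sum rG c) = 0.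
  by rewrite !mulmxA -er -(mulmxA _ (rG h)) -repr_SmM -mulmxA -ec mulmxA -/(young rG la) y0 mul0mx.
by move/(congr1 (mulmx (invmx (rG h)))); rewrite mulKmx ?repr_unit // mulmx0 => /eqP.
Qed.

(** If the product does not vanish, rows and [x]-translated columns are jointly injective, and
    [tab_row_stab] yields [h] preserving rows with [h * x] preserving columns. The factorization
    [x = h^-1 * (h * x)] is absorbed on the two sides, up to a sign. *)
Lemma young_sandwich la x : sumn la = m -> exists a : C,
  row_sum rG (tab_row la) *m rG x *m col_sum rG (tab_col la) = a *: young rG la.
Proof.
move=> lam; set M := _ *m col_sum _ _.
have [->|nz] := eqVneq M 0; first by exists 0; rewrite scale0r.
have [|h hE] := tab_row_stab lam (row_col_sum_inj nz).
  by rewrite [leqRHS](reindex_inj (@perm_inj _ x)).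
have hr : stabilizes (tab_row la) h by apply/stabilizesP => e; case: (hE e).
have hc : stabilizes (tab_col la) (h * x)%g.
  by apply/stabilizesP => e; rewrite permM; case: (hE e).
exists ((-1) ^+ odd_perm (h * x)).
by rewrite /M -{1}(row_sumMr rG hr) -(mulmxA _ (rG h)) -repr_SmM -mulmxA col_sumMl // -scalemxAr.
Qed.

Lemma young_envelop la Y : sumn la = m -> (Y \in enveloping_algebra_mx rG)%MS ->
  exists a : C, young rG la *m Y *m young rG la = a *: young rG la.
Proof.
move=> lam.
suff all Z : (Z \in enveloping_algebra_mx rG)%MS -> exists a : C,
    row_sum rG (tab_row la) *m Z *m col_sum rG (tab_col la) = a *: young rG la.
  move=> YE; rewrite /young.
  have [|a aE] := all (col_sum rG (tab_col la) *m Y *m row_sum rG (tab_row la)).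
    rewrite !envelop_mxM //.
      rewrite linear_sum summx_sub // => s _.
      by rewrite linearZ scalemx_sub // envelop_mx_id ?in_setT.
    by rewrite linear_sum summx_sub // => s _; rewrite envelop_mx_id ?in_setT.
  by exists a; rewrite -aE !mulmxA.
case/envelop_mxP => z ->.
exists (\sum_(g in [set: 'S_m]) z g * projT1 (cid (young_sandwich g lam))).
rewrite mulmx_lin_comb scaler_suml; apply: eq_bigr => g _.
by rewrite -scalerA -(projT2 (cid (young_sandwich g lam))).
Qed.

End OneRepresentation.
End YoungElements.

(** * Specht modules as right ideals of the group algebra *)

Lemma adjmxM (C : numClosedFieldType) m n p (A : 'M[C]_(m, n)) (B : 'M_(n, p)) :
  (A *m B)^t* = B^t* *m A^t*.
Proof. by rewrite trmx_mul map_mxM. Qed.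

Lemma mulmx_adj_eq0 (C : numClosedFieldType) m n (A : 'M[C]_(m, n)) :
  A *m A^t* = 0 -> A = 0.
Proof.
move=> A0; apply/matrixP => i j; have /matrixP/(_ i i) := A0.
rewrite !mxE => /eqP; rewrite psumr_eq0 => [/allP/(_ j)|l _].
  by rewrite mem_index_enum !mxE mul_conjC_eq0 => /(_ isT)/eqP.
by rewrite !mxE mul_conjC_ge0.
Qed.

Lemma mulmx_adj_mul_eq0 (C : numClosedFieldType) m n (A : 'M[C]_(m, n)) :
  A *m A^t* *m A = 0 -> A = 0.
Proof.
move=> A0; apply: mulmx_adj_eq0; apply: mulmx_adj_eq0.
by rewrite adjmxM trmxCK mulmxA A0 mul0mx.
Qed.

Section Specht.
Variables (C : numClosedFieldType) (m : nat).
Local Notation aG := (regular_Sm C m).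

Lemma young_symmetrizerE la : young_symmetrizer C m la = young aG la.
Proof.
rewrite /young /row_sum mulmx_suml /young_symmetrizer.
apply: eq_big => [p|p _]; first by rewrite inE.
rewrite /col_sum mulmx_sumr; apply: eq_big => [q|q _]; first by rewrite inE.
by rewrite repr_SmM scalemxAr.
Qed.

Lemma regular_adj g : (aG g)^t* = aG g^-1%g.
Proof.
apply/matrixP => i j; rewrite !mxE eqxx /= conjC_nat; congr (_%:R); congr nat_of_bool.
have G1 (x : 'S_m) : x \in [set: 'S_m]%g by rewrite in_setT.
apply/eqP/eqP => [->|->]; rewrite gring_indexK ?G1 //.
  by rewrite mulgK gring_valK.
by rewrite mulgKV gring_valK.
Qed.

Lemma envelop_adj Y : (Y \in group_ring C [set: 'S_m] -> Y^t* \in group_ring C [set: 'S_m])%MS.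
Proof.
case/envelop_mxP => y ->.
have -> : (\sum_(g in [set: 'S_m]%g) y g *: aG g)^t* =
    \sum_(g in [set: 'S_m]%g) (y g)^* *: aG g^-1%g.
  rewrite linear_sum raddf_sum; apply: eq_bigr => g _.
  by rewrite linearZ /= map_mxZ regular_adj.
rewrite linear_sum summx_sub // => g _.
by rewrite linearZ scalemx_sub // envelop_mx_id ?in_setT.
Qed.

Section Model.
Variable la : seq nat.
Hypothesis la_m : sumn la = m.
Local Notation e := (young_symmetrizer C m la).
Local Notation u0 := (gring_row e).

Lemma young_envelop_id : (e \in group_ring C [set: 'S_m])%MS.
Proof.
rewrite young_symmetrizerE envelop_mxM // linear_sum summx_sub // => s _.
  by rewrite envelop_mx_id ?in_setT.
by rewrite linearZ scalemx_sub // envelop_mx_id ?in_setT.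
Qed.

(** Let [X] be the row of [Z = e *m Y]. By [young_envelop], [Z] times its adjoint times [e] is a
    multiple [a] of [e]. If [a] were zero, [Z] times its adjoint times [Z] would vanish, and then so
    would [Z], by positivity. Hence each nonzero vector generates the whole Specht module. *)
Lemma specht_sub_fixed X : (X <= cyclic_mx aG u0)%MS -> X != 0 ->
  exists2 Y, (Y \in group_ring C [set: 'S_m])%MS & X *m Y = u0.
Proof.
case/cyclic_mxP => Y YE -> nz.
pose N := e *m Y *m (e *m Y)^t*.
have N0 : N *m e != 0.
  apply: contraNneq nz => N0; rewrite -gring_row_mul.
  by rewrite (@mulmx_adj_mul_eq0 _ _ _ (e *m Y)) ?linear0 // mulmxA N0 mul0mx.
have [a aE] : exists a : C, N *m e = a *: e.
  have [|a aE] := @young_envelop C m _ aG la (Y *m (e *m Y)^t*) la_m.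
    by rewrite envelop_mxM // envelop_adj // envelop_mxM // young_envelop_id.
  by rewrite -young_symmetrizerE in aE; exists a; rewrite /N -(mulmxA e).
have a0 : a != 0 by apply: contraNneq N0 => a0; rewrite aE a0 scale0r.
exists (a^-1 *: ((e *m Y)^t* *m e)).
  rewrite linearZ scalemx_sub // envelop_mxM ?young_envelop_id //.
  by rewrite envelop_adj // envelop_mxM // young_envelop_id.
rewrite -scalemxAr -!gring_row_mul mulmxA -/N aE linearZ /=.
by rewrite scalerA mulVf // scale1r.
Qed.

(** Acting on [v] maps the right ideal to the module of [rG]. The map is injective, since by
    [specht_sub_fixed] a nonzero kernel vector would bring [u0] into the kernel, and onto by
    irreducibility of [rG]. *)
Lemma irr_young_rsim d (rG : mx_representation C [set: 'S_m] d) :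
  mx_irreducible rG -> young rG la != 0 -> mx_rsim rG (specht_repr C m la).
Proof.
move=> irr nz; apply: mx_rsim_sym.
have [v vE] : exists v : 'rV_d, v *m young rG la != 0.
  apply: contrapT => none; case/eqP: nz; apply/row_matrixP => i.
  rewrite row0 rowE; apply/eqP/negPn/negP => nzi.
  by apply: none; exists (delta_mx 0 i).

pose Phi := lin1_mx (mulmx v \o gring_mx rG).
have PhiE X : X *m Phi = v *m gring_mx rG X by rewrite mul_rV_lin1.
have Phi_hom g : aG g *m Phi = Phi *m rG g.
  apply/row_matrixP => i; rewrite !rowE !mulmxA !PhiE gring_mxJ ?in_setT //.
  by rewrite mulmxA.
have Phi_u0 : u0 *m Phi = v *m young rG la.
  rewrite PhiE -gring_opE; congr (_ *m _).
  rewrite /young_symmetrizer linear_sum /young /row_sum mulmx_suml.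
  apply: eq_big => [p|p _]; first by rewrite inE.
  rewrite linear_sum /col_sum mulmx_sumr; apply: eq_big => [q|q _]; first by rewrite inE.
  by rewrite linearZ /= gring_opG ?in_setT // repr_SmM scalemxAr.
pose B := val_submod (U := cyclic_mx aG u0) 1%:M *m Phi.
have homB g : g \in [set: 'S_m]%g -> specht_repr C m la g *m B = B *m rG g.
  move=> Gg; rewrite /B mulmxA -val_submodE -mulmxA -Phi_hom mulmxA.
  by rewrite -[specht_repr C m la g]mul1mx val_submodJ.
have freeB : row_free B.
  apply: inj_row_free => x; rewrite mulmxA -val_submodE => x0.
  apply/eqP; rewrite -(val_submod_eq0 (U := cyclic_mx aG u0)).
  apply/negP => /negP nzx.
  have [Y /envelop_mxP[y ->]] := specht_sub_fixed (val_submodP _) nzx.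
  move/(congr1 (mulmx^~ Phi)); rewrite Phi_u0 -mulmxA mulmx_suml.
  under eq_bigr do rewrite -scalemxAl Phi_hom scalemxAr.
  by rewrite -mulmx_sumr mulmxA x0 mul0mx => /esym/eqP; rewrite (negPf vE).
have [d0 irrU] := (mx_irrP rG).1 irr.
exists B => //.
rewrite -(eqP freeB); apply/eqP; rewrite -/(row_full B).
suff: row_full <<B>>%MS by rewrite /row_full genmxE.
apply: irrU.
  by rewrite (eqmx_module _ (genmxE B)); apply/mxmoduleP => g Gg; rewrite -homB // submxMl.
rewrite -mxrank_eq0 genmxE mxrank_eq0; apply: contraNneq vE => B0.
rewrite -Phi_u0 -[u0](in_submodK (cyclic_mx_id aG u0)).
by rewrite val_submodE -mulmxA -/B B0 mulmx0.
Qed.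

Lemma specht_young_neq0 : (0 < \rank (cyclic_mx aG u0))%N ->
  young (specht_repr C m la) la != 0.
Proof.
rewrite lt0n mxrank_eq0 cyclic_mx_eq0 => nz.

(* The product of [e], its adjoint and [e] is a nonzero multiple of [e], so the Young element sends
   this test vector to a nonzero multiple of [u0]. *)
pose x := in_submod (cyclic_mx aG u0) (u0 *m e^t*).
have e0 : e != 0 by apply: contraNneq nz => ->; rewrite linear0.
have eE := young_envelop_id.
have eeE : (u0 *m e^t* <= cyclic_mx aG u0)%MS.
  by apply/cyclic_mxP; exists (e^t*); rewrite ?envelop_adj.
have [a aE] := young_envelop la_m (envelop_adj eE).
rewrite -young_symmetrizerE in aE.
have a0 : a != 0.
  apply: contraNneq e0 => a0; apply/eqP/mulmx_adj_mul_eq0.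
  by rewrite aE a0 scale0r.
have: x *m young (specht_repr C m la) la *m val_submod 1%:M != 0.
  rewrite -mulmxA (young_hom (rG2 := aG)) => [|g].
    rewrite mulmxA -val_submodE in_submodK // -young_symmetrizerE -!gring_row_mul aE.
    by rewrite linearZ /= scaler_eq0 negb_or a0.
  rewrite -val_submodE -[specht_repr C m la g]mul1mx val_submodJ ?in_setT //.
by apply: contraNneq => ->; rewrite mulmx0 mul0mx.
Qed.

End Model.
End Specht.

Lemma perm_of_fibers (m : nat) (T : eqType) (f f' : 'I_m -> T) :
    (forall t, #|[pred l | f l == t]| = #|[pred l | f' l == t]|) ->
  exists s : 'S_m, forall l, f (s l) = f' l.
Proof.
move=> card.
have /tuple_permP[s sE] : perm_eq [tuple f' l | l < m] [tuple f l | l < m].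
  have cE g t : count (pred1 t) [tuple g l | l < m] = #|[pred l | g l == t]|.
    by rewrite -sum1_count big_map big_enum_cond -sum1_card; apply: eq_bigl.
  by apply/allP => t _ /=; rewrite !cE card.
exists s => l; have := congr1 (fun u => nth (f l) u l) sE.
by rewrite !(nth_mktuple, tnth_mktuple).
Qed.

Lemma mxrank_sums (F : fieldType) n (I : finType) (P : pred I) (A : I -> 'M[F]_n) :
  (\rank (\sum_(i | P i) A i)%MS <= \sum_(i | P i) \rank (A i))%N.
Proof.
elim/big_ind2: _ => [|r1 M1 r2 M2 le1 le2|//]; first by rewrite mxrank0.
by apply: leq_trans (mxrank_adds_leqif _ _).1 _; apply: leq_add.
Qed.

(** * Isotypic components of tensor space *)

Section PlaceRepresentation.
Variables (C : numClosedFieldType) (n m : nat).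
Local Notation V := (place_repr C n m).
Local Notation word := (word n m).

Definition word_nat (w : word) (l : 'I_m) : nat := w l.

Lemma row_place_mx (v : word) s : row (enum_rank v) (place_mx C n s) =
  delta_mx 0 (enum_rank (place_word v s)).
Proof.
by apply/rowP => b; rewrite !mxE eqxx enum_rankK -(inj_eq enum_rank_inj) enum_valK.
Qed.

Lemma place_wordK (v v' : word) (s : 'S_m) : (forall l, v (s l) = v' l) -> place_word v s^-1%g = v'.
Proof. by move=> e; apply/ffunP => l; rewrite ffunE invgK. Qed.

(** A word with equal letters at two entries of one column is fixed by their transposition, hence
    killed by the antisymmetrizer. In a surviving word the first column carries [size la] distinct
    letters. *)
Lemma col_sum_place_size la : is_partition m la -> col_sum V (tab_col la) != 0 ->
  (size la <= n)%N.
Proof.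
case/and3P=> _ la0 /eqP lam nz.
have [v nzv] : exists v : word, row (enum_rank v) (col_sum V (tab_col la)) != 0.
  apply: contrapT => none; case/eqP: nz; apply/row_matrixP => i.
  rewrite row0; apply/eqP/negPn/negP => nzi.
  by apply: none; exists (enum_val i); rewrite enum_valK.
have inj x y : tab_col la x = tab_col la y -> v x = v y -> x = y.
  move=> cxy vxy; apply/eqP; apply: contraNT nzv => nxy.
  have := col_sumMl V (stabilizes_tperm cxy).
  rewrite odd_tperm nxy expr1 scaleN1r => /(congr1 (row (enum_rank v))).
  rewrite row_mul row_place_mx -rowE raddfN /=.
  rewrite -[tperm x y]invgK (place_wordK (v' := v)) => [/eqP|l]; last first.
    by rewrite tpermV; case: tpermP => [->|->|].
  by rewrite -addr_eq0 -mulr2n -scaler_nat scaler_eq0 pnatr_eq0.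
have cell i : (i < size la)%N -> exists2 e : 'I_m, tab_row la e = i & tab_col la e = 0%N.
  move=> lt; apply: tab_cell => //; rewrite lt0n; apply: contraNneq la0 => <-.
  exact: mem_nth.
rewrite -[size la]card_ord -[leqRHS]card_ord.
pose cs (i : 'I_(size la)) := cid2 (cell i (ltn_ord i)).
apply: (@leq_card _ _ (fun i => v (s2val (cs i)))) => i j /inj ij.
apply: val_inj => /=; rewrite -(s2valP (cs i)) -(s2valP (cs j)) ij //.
by rewrite !(s2valP' (cs _)).
Qed.

Section RowSpace.
Variable P : pred word.
Hypothesis P_place : forall w s, P (place_word w s) = P w.

Definition row_space : 'M[C]_#|{: word}| :=
  (\sum_(w : word | P w) <<row_sum V (word_nat w)>>)%MS.

Lemma row_space_module : mxmodule V row_space.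
Proof.
apply/mxmoduleP => g _; rewrite /row_space sumsmxMr; apply/sumsmx_subP => w Pw.
apply: (sumsmx_sup (place_word w g)); first by rewrite P_place.
rewrite (eqmxMr _ (genmxE _)) genmxE.
have -> : row_sum V (word_nat w) *m V g = V g *m row_sum V (word_nat (place_word w g)).
  rewrite -row_sumJ; congr (_ *m _); apply: eq_row_sum; apply: eq_stabilizes => l /=.
  by rewrite /word_nat ffunE permK.
exact: submxMl.
Qed.

Lemma simple_young_neq0 la M (modM : mxmodule V M) :
    mxsimple V M -> mx_rsim (submod_repr modM) (specht_repr C m la) ->
  sumn la = m -> M *m young V la != 0.
Proof.
move=> [_ M0 _] sim lam.
have [B eqn freeB homB] := mx_rsim_sym sim.
have nzS : young (specht_repr C m la) la != 0.
  by apply: specht_young_neq0 => //; rewrite eqn lt0n mxrank_eq0.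
have nzM : young (submod_repr modM) la != 0.
  apply: contraNneq nzS => yM0; rewrite -(mulmx_free_eq0 _ freeB).
  by rewrite (young_hom (rG2 := submod_repr modM)) ?yM0 ?mulmx0 // => g; rewrite homB ?in_setT.
have homM g : submod_repr modM g *m val_submod 1%:M = val_submod 1%:M *m V g.
  by rewrite -val_submodE -[submod_repr modM g]mul1mx val_submodJ ?in_setT.
apply: contraNneq nzM => MY0.
rewrite -(mulmx_free_eq0 _ (_ : row_free (val_submod (U := M) 1%:M))); last first.
  by rewrite /row_free val_submod1.
rewrite (young_hom homM).
by have /submxP[D ->] : (val_submod (U := M) 1%:M <= M)%MS; [apply: val_submodP | rewrite -mulmxA MY0 mulmx0].
Qed.

(** The row symmetrizer of [w] does not vanish on [M]; its image of [M] is a nonzero part of [M]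
    inside the module [row_space], and simplicity does the rest. *)
Lemma simple_sub_row_space la (w : word) M (modM : mxmodule V M) :
    mxsimple V M -> mx_rsim (submod_repr modM) (specht_repr C m la) ->
    sumn la = m -> P w -> tab_row la =1 word_nat w ->
  (M <= row_space)%MS.
Proof.
move=> simM sim lam Pw tw; have nz := simple_young_neq0 simM sim lam.
case: simM => _ _ minM.
pose X := M *m row_sum V (tab_row la).
have X0 : X != 0 by apply: contraNneq nz; rewrite /young mulmxA -/X => ->; rewrite mul0mx.
have XM : (X <= M)%MS.
  rewrite /X mulmx_sumr summx_sub // => g _.
  by have /mxmoduleP/(_ g) := modM; apply; rewrite in_setT.
have XR : (X <= row_space)%MS.
  rewrite /X (eq_row_sum _ (eq_stabilizes tw)) (submx_trans (submxMl _ _)) //.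
  by apply: (sumsmx_sup w) => //; rewrite genmxE.
have: (M <= M :&: row_space)%MS.
  apply: minM; rewrite ?capmx_module ?row_space_module ?capmxSl //.
  by apply: contraNneq X0 => c0; rewrite -submx0 -c0 sub_capmx XM.
by rewrite sub_capmx => /andP[].
Qed.

End RowSpace.

Lemma simple_size la M (modM : mxmodule V M) :
    mxsimple V M -> mx_rsim (submod_repr modM) (specht_repr C m la) ->
  is_partition m la -> (size la <= n)%N.
Proof.
move=> simM sim lap; apply: (col_sum_place_size lap).
have lam : sumn la = m by case/and3P: lap => _ _ /eqP.
have := simple_young_neq0 simM sim lam; apply: contraNneq => c0.
by rewrite /young c0 !mulmx0.
Qed.

Lemma isotypic_proj_size la : is_partition m la -> isotypic_proj C n m la != 0 ->
  (size la <= n)%N.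
Proof.
move=> lap nz.
have [W simW] : exists W : DecSocleType V, mx_rsim (socle_repr W) (specht_repr C m la).
  apply: contrapT => none; case/eqP: nz; rewrite /isotypic_proj.
  have -> : isotypic C n m la = 0.
    by rewrite /isotypic big1 // => W /asboolP sW; case: none; exists W.
  apply/eqP; rewrite -submx0 -[X in (X <= _)%MS]mul1mx.
  exact: proj_mx_sub.
exact: simple_size (socle_simple W) simW lap.
Qed.

Definition word_power (g : 'M[C]_n) : 'M[C]_#|{: word}| :=
  \matrix_(a, b) \prod_l g ((enum_val a : word) l) ((enum_val b : word) l).

Lemma place_word_power g s : place_mx C n s *m word_power g = word_power g *m place_mx C n s.
Proof.
apply/matrixP => a b; rewrite !mxE.
rewrite (bigD1 (enum_rank (place_word (enum_val a) s))) //= !mxE enum_rankK eqxx mul1r.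
rewrite [X in _ + X = _]big1 ?addr0 => [|c]; last first.
  by rewrite -(inj_eq enum_val_inj) enum_rankK !mxE => /negPf->; rewrite mul0r.
rewrite [RHS](bigD1 (enum_rank (place_word (enum_val b) s^-1%g))) //= !mxE enum_rankK.
have bE : place_word (place_word (enum_val b) s^-1%g) s = enum_val b.
  by apply/ffunP => l; rewrite !ffunE invgK permKV.
rewrite bE eqxx mulr1 [X in _ = _ + X]big1 ?addr0 => [|c].
  rewrite (reindex_inj (@perm_inj _ s)); apply: eq_bigr => l _.
  by rewrite !ffunE invgK permK.
move=> neq; rewrite !mxE; case: eqP => [e|]; last by rewrite mulr0.
case/eqP: neq; apply: enum_val_inj; rewrite enum_rankK; apply/ffunP => l.
by rewrite ffunE invgK; move/ffunP/(_ (s l)): e; rewrite !ffunE !permK.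
Qed.

Lemma row_space_power P g : (row_space P *m word_power g <= row_space P)%MS.
Proof.
rewrite /row_space sumsmxMr; apply/sumsmx_subP => w Pw.
apply: (sumsmx_sup w) => //; rewrite (eqmxMr _ (genmxE _)) genmxE.
rewrite (row_sum_hom (rG2 := V)) ?submxMl // => s.
exact: place_word_power.
Qed.

(* The orbit of a word v under the stabilizer of w is determined by the joint
   type of (w, v), and row v of the symmetrizer of w only depends on this orbit. *)
Lemma rank_row_sum (w : word) :
  (\rank (row_sum V (word_nat w)) <= m.+1 ^ (n * n))%N.
Proof.
pose T := {ffun 'I_n * 'I_n -> 'I_m.+1}.
pose ty (v : word) : T :=
  [ffun ij => inord #|[pred l | (w l, v l) == ij]|].
pose f (t : T) : 'rV[C]_#|{: word}| :=
  if [pick v | ty v == t] is Some v then row (enum_rank v) (row_sum V (word_nat w)) else 0.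
pose B := \matrix_(i < #|{: T}|) f (enum_val i).
have sub : (row_sum V (word_nat w) <= B)%MS.
  apply/row_subP => a; rewrite -(enum_valK a); set v := enum_val a.
  suff -> : row (enum_rank v) (row_sum V (word_nat w)) = row (enum_rank (ty v)) B.
    exact: row_sub.
  rewrite rowK enum_rankK /f; case: pickP => [u /eqP eqty|/(_ v)]; last by rewrite eqxx.
  have [s sE] : exists s : 'S_m, forall l, (w (s l), u (s l)) = (w l, v l).
    apply: (perm_of_fibers (f := fun l => (w l, u l)) (f' := fun l => (w l, v l))) => ij.
    have /(congr1 val) := congr1 (fun t : T => t ij) eqty.
    by rewrite !ffunE /= !inordK // ltnS -[leqRHS](card_ord m) max_card.
  rewrite -[in RHS](row_sumMl V (_ : stabilizes (word_nat w) s^-1%g)); last first.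
    rewrite stabilizesV; apply/stabilizesP => l.
    by rewrite /word_nat; case: (sE l) => ->.
  rewrite row_mul row_place_mx -rowE (place_wordK (v' := v)) // => l.
  by case: (sE l).
apply: leq_trans (mxrankS sub) _; apply: leq_trans (rank_leq_row _) _.
by rewrite card_ffun card_prod !card_ord.
Qed.

Lemma rank_row_space P : (\rank (row_space P) <= #|P| * m.+1 ^ (n * n))%N.
Proof.
apply: leq_trans (mxrank_sums _ _) _.
rewrite -sum_nat_const; apply: leq_sum => w _.
by rewrite genmxE rank_row_sum.
Qed.

(** [I] enumerates the isotypic components, so each projector occurs only once in the sum. The
    difference from the identity is the projection onto the remaining components, whose simple
    summands all lie in [row_space P]. *)
Lemma isotypic_decomposition (P : pred word) (good : pred (seq nat)) :
    (forall w s, P (place_word w s) = P w) ->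
    (forall la w, is_partition m la -> ~~ good la -> tab_row la =1 word_nat w -> P w) ->
  exists (I : finType) (la : I -> seq nat), (forall i, is_partition m (la i)) /\
    (1%:M - \sum_(i | good (la i)) isotypic_proj C n m (la i) <= row_space P)%MS.
Proof.
move=> P_place P_bad.
have ex (W : DecSocleType V) : exists la, is_partition m la /\
    mx_rsim (socle_repr W) (specht_repr C m la).
  have irr : mx_irreducible (socle_repr W) by apply/submod_mx_irr; apply: socle_simple.
  have [la lap nz] := irr_young irr; exists la; split=> //.
  by apply: irr_young_rsim => //; case/and3P: lap => _ _ /eqP.
pose la W := projT1 (cid (ex W)).
have lap W : is_partition m (la W) by case: (projT2 (cid (ex W))).
have simW W : mx_rsim (socle_repr W) (specht_repr C m (la W)) by case: (projT2 (cid (ex W))).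
exists (DecSocleType V), la; split=> //.
have simE W W' : `[< mx_rsim (socle_repr W') (specht_repr C m (la W)) >] = (W' == W).
  apply/asboolP/socle_rsimP => [sW'|sW']; last by apply: mx_rsim_trans sW' (simW W).
  by apply: mx_rsim_trans sW' (mx_rsim_sym (simW W)).
have isoE W : (isotypic C n m (la W) :=: W)%MS.
  apply/eqmxP/andP; split.
    by apply/sumsmx_subP => W'; rewrite simE => /eqP->.
  by apply: (sumsmx_sup W); rewrite ?simE.
have disj W : (isotypic C n m (la W) :&: coisotypic C n m (la W) = 0)%MS.
  apply/eqP; rewrite -submx0 (cap_eqmx (isoE W) (eqmx_refl _)) /coisotypic.
  have /mxdirect_sumsP/(_ W isT) dW := Socle_direct (DecSocleType V).
  rewrite -[X in (_ <= X)%MS]dW capmxS //;  apply/sumsmx_subP => W'; rewrite simE => neq.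
  by apply: (sumsmx_sup W').
have projE (W W' : DecSocleType V) : W' *m isotypic_proj C n m (la W) = if W' == W then W' : 'M_ _ else 0.
  rewrite /isotypic_proj; case: ifP => [/eqP->|neq].
    by rewrite proj_mx_id ?isoE.
  by rewrite proj_mx_0 //; apply: (sumsmx_sup W'); rewrite ?simE ?neq.
have tot : (1%:M <= \sum_(W : DecSocleType V) W)%MS.
  rewrite -/(Socle _) reducible_Socle1 //; apply: mx_Maschke_pchar.
  by rewrite /pgroup pcharf'_nat pnatr_eq0 -lt0n cardG_gt0.
rewrite -[X in (X <= _)%MS]mul1mx; apply: submx_trans (submxMr _ tot) _.
rewrite sumsmxMr; apply/sumsmx_subP => W _.
rewrite mulmxBr mulmx1 mulmx_sumr; under eq_bigr do rewrite projE.
case gW: (good (la W)).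
  rewrite (bigD1 W) //= eqxx big1 ?addr0 ?subrr ?sub0mx // => W' /andP[_ neq].
  by rewrite eq_sym (negPf neq).
rewrite big1 => [|W' gW']; last by case: eqP => // e; rewrite -e gW in gW'.
rewrite subr0.
have simp M (modM : mxmodule V M) : mxsimple V M -> mx_rsim (submod_repr modM) (socle_repr W) ->
    (M <= row_space P)%MS.
  move=> simM sM; have sM' := mx_rsim_trans sM (simW W).
  have lam : sumn (la W) = m by case/and3P: (lap W) => _ _ /eqP.
  have sz := simple_size simM sM' (lap W).
  (* The word of the row indices of the tableau; [simple_size] ensures that they are letters. *)
  pose w : word := [ffun l => Ordinal (leq_trans (tab_row_lt lam l) sz)].
  apply: (simple_sub_row_space (w := w) P_place simM sM') => // [|l].
    by apply: (P_bad (la W)); rewrite ?gW // => l; rewrite /word_nat ffunE.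
  by rewrite /word_nat ffunE.
have [J [U isoU UE]] := component_mx_def (socle_simple W).
rewrite [X in (X <= _)%MS](_ : _ = component_mx V (socle_base W)) // UE.
apply/sumsmx_subP => j _; have simU := mx_iso_simple (isoU j) (socle_simple W).
apply: (simp _ (mxsimple_module simU)) => //.
by apply/mx_rsim_iso; apply: mx_iso_sym.
Qed.

End PlaceRepresentation.

(** * Operators acting on the legs of a tensor *)

Lemma prod_sum_dffun (C : comNzRingType) (I : finType) (T : I -> finType)
    (F : forall i, T i -> C) :
  \prod_i \sum_x F i x = \sum_(v : {dffun forall i, T i}) \prod_i F i (v i).
Proof.
rewrite (reindex (@dffun_of_fprod I T)); last exact/onW_bij/dffun_of_fprod_bij.
pose G i : {ffun T i -> C} := [ffun x => F i x].
transitivity (\sum_(t : fprod T) \prod_(i in I) G i (t i)); last first.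
  by apply: eq_bigr => t _; apply: eq_bigr => i _; rewrite !ffunE.
rewrite big_fprod.
transitivity (\prod_i \sum_(u in tagged_with T i) untag 0 (G i) u); last first.
  exact: bigA_distr_big_dep.
apply: eq_bigr => i _; transitivity (\sum_x G i x).
  by apply: eq_bigr => x _; rewrite ffunE.
exact: (big_tag (fun i => G i)).
Qed.

Section Tensors.
Variables (C : numClosedFieldType) (I : finType).
Implicit Types T U : I -> finType.

Notation idx T := {dffun forall i : I, T i}.

Definition tens T U (M : forall i, T i -> U i -> C) (X : idx T -> C) (w : idx U) : C :=
  \sum_v X v * \prod_i M i (v i) (w i).

Definition kmul (T U V : finType) (M : T -> U -> C) (N : U -> V -> C) x z : C :=
  \sum_y M x y * N y z.

Definition kdelta (T : finType) (x y : T) : C := (x == y)%:R.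

Definition kgram (T U : finType) (M : T -> U -> C) x x' : C :=
  \sum_y M x y * (M x' y)^*.

(** The squared norm of [tens M X] with the Gram kernels of [M] replaced by arbitrary [H]: it is
    additive in each [H i], which permits an expansion leg by leg. *)
Definition quad T (H : forall i, T i -> T i -> C) (X : idx T -> C) : C :=
  \sum_v \sum_v' X v * (X v')^* * \prod_i H i (v i) (v' i).

Definition nrm2 (T : finType) (X : T -> C) : C := \sum_w `|X w| ^+ 2.

Lemma nrm2_ge0 (T : finType) (X : T -> C) : 0 <= nrm2 X.
Proof. by apply: sumr_ge0 => w _; rewrite exprn_ge0. Qed.

Lemma eq_tens T U (M N : forall i, T i -> U i -> C) X Y w :
  (forall i, M i =2 N i) -> X =1 Y -> tens M X w = tens N Y w.
Proof.
move=> eM eX; apply: eq_bigr => v _; rewrite eX; congr (_ * _).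
by apply: eq_bigr => i _; rewrite eM.
Qed.

Lemma eq_quad T (H K : forall i, T i -> T i -> C) X :
  (forall i, H i =2 K i) -> quad H X = quad K X.
Proof.
move=> e; apply: eq_bigr => v _; apply: eq_bigr => v' _; congr (_ * _).
by apply: eq_bigr => i _; rewrite e.
Qed.

Lemma tens_comp T U (V : I -> finType) (M : forall i, T i -> U i -> C) (N : forall i, U i -> V i -> C) X w :
  tens N (tens M X) w = tens (fun i => kmul (M i) (N i)) X w.
Proof.
rewrite /tens; under eq_bigr do rewrite mulr_suml.
rewrite exchange_big; apply: eq_bigr => v _ /=.
under eq_bigr do rewrite -mulrA -big_split /=.
by rewrite -mulr_sumr prod_sum_dffun.
Qed.

Lemma tens_delta T X (w : idx T) : tens (fun i => @kdelta (T i)) X w = X w.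
Proof.
rewrite /tens (bigD1 w) //= [X in _ * X]big1 => [|i _]; last by rewrite /kdelta eqxx.
rewrite mulr1 big1 ?addr0 // => v nvw.
have [i nvi] : exists i, v i != w i.
  by apply/existsP; apply: contraNT nvw => /existsPn e; apply/eqP/ffunP => i; apply/eqP/negPn/e.
by rewrite (bigD1 i) //= /kdelta (negPf nvi) mul0r mulr0.
Qed.

Lemma nrm2_tens T U (M : forall i, T i -> U i -> C) X :
  nrm2 (tens M X) = quad (fun i => kgram (M i)) X.
Proof.
rewrite /nrm2 /quad; under eq_bigr => w _.
  rewrite normCK /tens rmorph_sum big_distrlr /=; over.
rewrite exchange_big; apply: eq_bigr => v _; rewrite exchange_big; apply: eq_bigr => v' _ /=.
rewrite /kgram prod_sum_dffun mulr_sumr; apply: eq_bigr => w _.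
by rewrite rmorphM rmorph_prod mulrACA big_split.
Qed.

Lemma nrm2_quad T (X : idx T -> C) : nrm2 X = quad (fun i => @kdelta (T i)) X.
Proof.
transitivity (nrm2 (tens (fun i => @kdelta (T i)) X)).
  by apply: eq_bigr => w _; rewrite tens_delta.
rewrite nrm2_tens; apply: eq_quad => i x y.
rewrite /kgram /kdelta (bigD1 x) //= eqxx mul1r conjC_nat eq_sym big1 ?addr0 // => z.
by rewrite eq_sym => /negPf->; rewrite mul0r.
Qed.

Lemma quad_split T (H : bool -> forall i, T i -> T i -> C) (K : forall i, T i -> T i -> C) X :
    (forall i x y, K i x y = H true i x y + H false i x y) ->
  quad K X = \sum_(J : {ffun I -> bool}) quad (fun i => H (J i) i) X.
Proof.
move=> e; rewrite /quad [RHS]exchange_big; apply: eq_bigr => v _ /=.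
rewrite [RHS]exchange_big; apply: eq_bigr => v' _ /=; rewrite -mulr_sumr; congr (_ * _).
under eq_bigr => i _ do rewrite e -(big_bool _ (fun b => H b i (v i) (v' i))).
by rewrite bigA_distr_bigA.
Qed.

Definition leg T (j : I) (M : forall i, T i -> T i -> C) i : T i -> T i -> C :=
  if i == j then M i else @kdelta (T i).

Definition kcompl (T : finType) (M : T -> T -> C) x y : C := kdelta x y - M x y.

(* Expanding the identity as the product over the legs of P_i + (1 - P_i), every
   term except the product of all the 1 - P_i contains some P_j. *)
Lemma nrm2_le_legs T (P : forall i, T i -> T i -> C) X :
    (forall i, kgram (P i) =2 P i) -> (forall i x y, P i y x = (P i x y)^*) ->
    (forall w, tens (fun i => kcompl (P i)) X w = 0) ->
  nrm2 X <= \sum_j nrm2 (tens (leg j P) X).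
Proof.
move=> gP cP X0.
have gQ i : kgram (kcompl (P i)) =2 kcompl (P i).
  move=> x y; have dl (f : T i -> C) z : \sum_u kdelta z u * f u = f z.
    rewrite (bigD1 z) //= /kdelta eqxx mul1r big1 ?addr0 // => u.
    by rewrite eq_sym => /negPf->; rewrite mul0r.
  transitivity (\sum_z kdelta x z * (kdelta y z - P i z y) -
      \sum_z kdelta y z * P i x z + kgram (P i) x y).
    rewrite /kgram -sumrB -big_split; apply: eq_bigr => z _ /=.
    by rewrite /kcompl rmorphB /= -cP /kdelta conjC_nat; ring.
  by rewrite !dl gP subrK /kcompl /kdelta eq_sym.
pose H (b : bool) i := if b then P i else kcompl (P i).
have qJ J : quad (fun i => H (J i) i) X = nrm2 (tens (fun i => H (J i) i) X).
  rewrite nrm2_tens; apply: eq_quad => i x y.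
  by rewrite /H; case: (J i); rewrite ?gP ?gQ.
have qJ0 J : 0 <= quad (fun i => H (J i) i) X by rewrite qJ nrm2_ge0.
have qleg j : nrm2 (tens (leg j P) X) = \sum_(J : {ffun I -> bool} | J j) quad (fun i => H (J i) i) X.
  rewrite nrm2_tens.
  transitivity (quad (leg j P) X).
    apply: eq_quad => i x y; rewrite /leg; case: eqP => _; first exact: gP.
    rewrite /kgram (bigD1 x) //= /kdelta eqxx mul1r conjC_nat eq_sym big1 ?addr0 // => z.
    by rewrite eq_sym => /negPf->; rewrite mul0r.
  (* Leg [j] is split as [P j + 0] and every other leg as [P i] plus its complement, so exactly the
     subsets containing [j] survive. *)
  rewrite (@quad_split _ (fun b i => if (i == j) && ~~ b then fun _ _ => 0 else H b i)).
    rewrite (bigID (fun J : {ffun I -> bool} => J j)) /= [X in _ + X]big1 ?addr0.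
      apply: eq_bigr => J Jj; apply: eq_quad => i x y.
      by case: (boolP (i == j)) => //= /eqP ij; rewrite (_ : J i) // ij.
    move=> J /negPf Jj; rewrite /quad big1 // => v _; rewrite big1 // => v' _.
    by rewrite (bigD1 j) //= eqxx Jj mul0r mulr0.
  move=> i x y; rewrite /leg; case: (i == j); rewrite /= ?addr0 //.
  by rewrite /kcompl addrC subrK.
rewrite nrm2_quad (@quad_split _ H) => [|i x y]; last by rewrite /= /kcompl addrC subrK.
rewrite (eq_bigr _ (fun j _ => qleg j)).
rewrite [leRHS](exchange_big_dep xpredT) //=; apply: ler_sum => J _.
have [[j Jj]|none] := pselect (exists j, J j).
  by rewrite (bigD1 j) //= lerDl sumr_ge0.
rewrite qJ big_pred0 => [|j]; last by apply/negP => Jj; case: none; exists j.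
rewrite /nrm2 big1 // => w _; rewrite (_ : tens _ _ _ = 0) ?normr0 ?expr0n //.
rewrite -(X0 w); apply: eq_tens => // i; rewrite /H.
by case Ji: (J i) => //; case: none; exists i.
Qed.

Definition subst_leg T (w : idx T) (j : I) (x : T j) : idx T := finfun (dfwith w x).

Lemma subst_leg_in T (w : idx T) j (x : T j) : subst_leg w x j = x.
Proof. by rewrite ffunE dfwith_in. Qed.

Lemma subst_leg_out T (w : idx T) j (x : T j) i : i != j -> subst_leg w x i = w i.
Proof. by move=> ij; rewrite ffunE dfwith_out // eq_sym. Qed.

Lemma subst_legK T (w : idx T) j (x y : T j) : subst_leg (subst_leg w x) y = subst_leg w y.
Proof.
apply/ffunP => i; have [->|ij] := eqVneq i j; first by rewrite !subst_leg_in.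
by rewrite !subst_leg_out.
Qed.

Lemma subst_leg_id T (w : idx T) j : subst_leg w (w j) = w.
Proof.
apply/ffunP => i; have [->|ij] := eqVneq i j; first by rewrite !subst_leg_in.
by rewrite !subst_leg_out.
Qed.

Lemma tens_leg T j (M : forall i, T i -> T i -> C) X w :
  tens (leg j M) X w = \sum_(x : T j) X (subst_leg w x) * M j x (w j).
Proof.
rewrite /tens (partition_big (fun v : idx T => v j) xpredT) //=; apply: eq_bigr => x _.
rewrite (bigD1 (subst_leg w x)) ?subst_leg_in //= (bigD1 j) //= subst_leg_in /leg eqxx.
rewrite [X in _ * (_ * X)]big1 ?mulr1 => [|i ij]; last first.
  by rewrite (negPf ij) subst_leg_out // /kdelta eqxx.
rewrite big1 ?addr0 // => v /andP[/eqP vj nvw].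
have [i nij nvi] : exists2 i, i != j & v i != w i.
  apply: contrapT => none; case/eqP: nvw; apply/ffunP => i.
  have [->|ij] := eqVneq i j; first by rewrite subst_leg_in.
  rewrite subst_leg_out //; apply/eqP/negPn/negP => nvi.
  by apply: none; exists i.
by rewrite (bigD1 i) //= (negPf nij) /kdelta (negPf nvi) mul0r mulr0.
Qed.

Lemma sum_subst_leg (A : nmodType) T j (f : idx T -> A) :
  \sum_w \sum_(x : T j) f (subst_leg w x) = (\sum_w f w) *+ #|T j|.
Proof.
rewrite pair_bigA /=.
pose h (p : idx T * T j) := (subst_leg p.1 p.2, p.1 j).
have hK : involutive h by move=> [w x]; rewrite /h /= subst_legK subst_leg_id subst_leg_in.
rewrite (reindex_inj (inv_inj hK)) /=.
transitivity (\sum_(p : idx T * T j) f p.1).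
  by apply: eq_bigr => -[w x] _ /=; rewrite subst_legK subst_leg_id.
rewrite -(pair_bigA _ (fun w (x : T j) => f w)) /= -sumrMnl; apply: eq_bigr => w _.
by rewrite sumr_const.
Qed.

(* X, flattened along leg j, has operator norm at most the square root of c; the
   coordinate w j is redundant on the left, whence the factor #|T j|. *)
Definition leg_bound T (X : idx T -> C) (j : I) (c : C) : Prop :=
  forall u : T j -> C, \sum_w `|\sum_(x : T j) X (subst_leg w x) * u x| ^+ 2
    <= c * nrm2 u *+ #|T j|.

(** The bound is applied to each column of [M j]. For an orthogonal projection the double sum is its
    rank, so a subspace of leg [j] carries at most [c] times its dimension. *)
Lemma nrm2_tens_leg T j (M : forall i, T i -> T i -> C) X c :
  leg_bound X j c -> nrm2 (tens (leg j M) X) <= c * \sum_x \sum_y `|M j x y| ^+ 2.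
Proof.
move=> bX; have [Tj0|Tj] := posnP #|T j|.
  rewrite /nrm2 [leLHS]big1 => [|w _]; last by have := fintype0 (w j) Tj0.
  by rewrite [X in c * X]big1 ?mulr0 // => x _; have := fintype0 x Tj0.
rewrite -(ler_pMn2r Tj) /nrm2 -(sum_subst_leg j (fun w => `|tens (leg j M) X w| ^+ 2)).
rewrite exchange_big [X in c * X]exchange_big /= mulr_sumr -sumrMnl; apply: ler_sum => y _; apply: le_trans (bX _).
apply: ler_sum => w _; rewrite tens_leg subst_leg_in.
by under eq_bigr do rewrite subst_legK.
Qed.

End Tensors.

(** * Tensor powers of the bound on one leg *)

Notation mindex T := {dffun forall i, T i}.

Lemma big_ffun_ordS (S : nmodType) (A : finType) m (F : {ffun 'I_m.+1 -> A} -> S) :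
  \sum_f F f = \sum_a \sum_(f : {ffun 'I_m -> A}) F [ffun i => oapp f a (unlift ord0 i)].
Proof.
rewrite pair_bigA /=.
rewrite (reindex (fun p : A * {ffun 'I_m -> A} => [ffun i => oapp p.2 p.1 (unlift ord0 i)])) //.
exists (fun f : {ffun 'I_m.+1 -> A} => (f ord0, [ffun i => f (lift ord0 i)])) => [[a f]|f] _ /=.
  rewrite ffunE unlift_none /=; congr (_, _); apply/ffunP => i.
  by rewrite !ffunE liftK.
by apply/ffunP => i; rewrite ffunE; case: unliftP => [j|] -> //=; rewrite ffunE.
Qed.

Section KernelPower.
Variables (C : numClosedFieldType) (A B : finType) (S : A -> B -> C) (K : C).
Hypothesis K0 : 0 <= K.
Hypothesis boundS : forall u : A -> C,
  \sum_b `|\sum_a u a * S a b| ^+ 2 <= K * nrm2 u.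

(** Operator norms multiply under tensor powers: [boundS] handles the first letter, and the
    induction hypothesis the others with the first letter fixed. *)
Lemma kernel_power_bound m (u : {ffun 'I_m -> A} -> C) :
  \sum_(b : {ffun 'I_m -> B})
    `|\sum_(a : {ffun 'I_m -> A}) u a * \prod_l S (a l) (b l)| ^+ 2 <= K ^+ m * nrm2 u.
Proof.
have big0 (S' : nmodType) (D : finType) (F : {ffun 'I_0 -> D} -> S') :
    \sum_f F f = F (ffun0 (card_ord 0)).
  by apply: big_pred1 => f; apply/esym/eqP/ffunP; case.
elim: m u => [|m IH] u.
  by rewrite expr0 mul1r /nrm2 !big0 big_ord0 mulr1.
rewrite big_ffun_ordS exchange_big /=.
pose cons D (a : D) (f : {ffun 'I_m -> D}) : {ffun 'I_m.+1 -> D} :=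
  [ffun i => oapp f a (unlift ord0 i)].
have cons0 D (a : D) f : cons D a f ord0 = a by rewrite ffunE unlift_none.
have consS D (a : D) f l : cons D a f (lift ord0 l) = f l by rewrite ffunE liftK.
pose v (b : {ffun 'I_m -> B}) a0 := \sum_(a : {ffun 'I_m -> A}) u (cons _ a0 a) * \prod_l S (a l) (b l).
have lhsE b : \sum_b0 `|\sum_a u a * \prod_l S (a l) (cons _ b0 b l)| ^+ 2 =
    \sum_b0 `|\sum_a0 v b a0 * S a0 b0| ^+ 2.
  apply: eq_bigr => b0 _; congr (`| _ | ^+ 2).
  rewrite big_ffun_ordS; apply: eq_bigr => a0 _.
  rewrite /v mulr_suml; apply: eq_bigr => a _.
  rewrite big_ord_recl -!/(cons _ _ _) !cons0 [RHS]mulrAC -mulrA; congr (_ * (_ * _)).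
  by apply: eq_bigr => l _; rewrite !consS.
under eq_bigr => b _ do rewrite lhsE.
have step : \sum_b \sum_b0 `|\sum_a0 v b a0 * S a0 b0| ^+ 2 <= \sum_b K * nrm2 (v b).
  by apply: ler_sum => b _; apply: boundS.
apply: le_trans step _; rewrite -mulr_sumr exprS -mulrA; apply: ler_wpM2l => //.
rewrite /nrm2 exchange_big /= [in leRHS]big_ffun_ordS mulr_sumr.
by apply: ler_sum => a0 _; apply: (IH (fun a => u (cons _ a0 a))).
Qed.

End KernelPower.

Section TensorPower.
Variables (C : numClosedFieldType) (k : nat) (n : 'I_k -> nat) (m : nat).

Notation ix := (mindex (fun i => 'I_(n i))).
Notation wx := (mindex (fun i => word (n i) m)).

Definition letter (w : wx) (l : 'I_m) : ix := finfun (fun i => w i l).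

Definition xpow (X : ix -> C) (w : wx) : C := \prod_l X (letter w l).

Lemma reindex_letters (S : nmodType) (F : {ffun 'I_m -> ix} -> S) :
  \sum_V F V = \sum_(w : wx) F [ffun l => letter w l].
Proof.
apply: (reindex (fun w : wx => [ffun l => letter w l])).
exists (fun V : {ffun 'I_m -> ix} => finfun (fun i => [ffun l => V l i]) : wx) => [w|V] _.
  by apply/ffunP => i; rewrite ffunE; apply/ffunP => l; rewrite !ffunE.
by apply/ffunP => l; rewrite ffunE; apply/ffunP => i; rewrite !ffunE.
Qed.

Lemma nrm2_xpow X : nrm2 (xpow X) = nrm2 X ^+ m.
Proof.
rewrite /nrm2 -[X in _ = _ ^+ X](card_ord m) -prodr_const bigA_distr_bigA /=.
rewrite reindex_letters; apply: eq_bigr => w _.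
by rewrite /xpow normr_prod -prodrXl; apply: eq_bigr => l _; rewrite ffunE.
Qed.

Lemma leg_bound_xpow X j c : 0 <= c -> leg_bound X j c -> leg_bound (xpow X) j (c ^+ m).
Proof.
move=> c0 bX u.
have bS v : \sum_w `|\sum_(x : 'I_(n j)) v x * X (subst_leg w x)| ^+ 2
    <= (c *+ n j) * nrm2 v.
  by under eq_bigr do under eq_bigr do rewrite mulrC; apply: le_trans (bX v) _; rewrite card_ord mulrnAl.
have nc0 : 0 <= c *+ n j by rewrite mulrn_wge0.
have := kernel_power_bound nc0 bS u.
rewrite reindex_letters exprMn_n card_ffun !card_ord mulrnAl.
apply: le_trans; rewrite le_eqVlt; apply/orP; left; apply/eqP.
apply: eq_bigr => w _; congr (`| _ | ^+ 2); apply: eq_bigr => x _; rewrite mulrC.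
congr (_ * _); apply: eq_bigr => l _; congr X; apply/ffunP => i.
rewrite ffunE.
have [->|ij] := eqVneq i j; first by rewrite !subst_leg_in.
by rewrite !subst_leg_out // !ffunE.
Qed.

Definition word_kernel (M : forall i, 'I_(n i) -> 'I_(n i) -> C) i
    (v w : word (n i) m) : C := \prod_l M i (v l) (w l).

Lemma xpow_tens M X w : xpow (tens M X) w = tens (word_kernel M) (xpow X) w.
Proof.
rewrite /xpow /tens bigA_distr_bigA /= reindex_letters; apply: eq_bigr => v _.
rewrite big_split /=; congr (_ * _); first by apply: eq_bigr => l _; rewrite ffunE.
rewrite exchange_big; apply: eq_bigr => i _; apply: eq_bigr => l _.
by rewrite !ffunE.
Qed.

End TensorPower.

Section KernelMatrix.
Variables (C : numClosedFieldType) (T : finType).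
Implicit Types M N : 'M[C]_#|T|.

Definition kmx M (x y : T) : C := M (enum_rank x) (enum_rank y).

Lemma sum_enum_rank (S : nmodType) (F : 'I_#|T| -> S) : \sum_a F a = \sum_x F (enum_rank x).
Proof. by apply: reindex; apply/onW_bij/enum_rank_bij. Qed.

Lemma kmx_mul M N : kmul (kmx M) (kmx N) =2 kmx (M *m N).
Proof. by move=> x z; rewrite /kmul /kmx mxE sum_enum_rank. Qed.

Lemma kmx_gram M : kgram (kmx M) =2 kmx (M *m M^t*).
Proof.
move=> x z; rewrite /kgram /kmx mxE sum_enum_rank.
by apply: eq_bigr => y _; rewrite !mxE.
Qed.

Lemma kcompl_kmx M : kcompl (kmx M) =2 kmx (1%:M - M).
Proof. by move=> x z; rewrite /kcompl /kmx /kdelta !mxE (inj_eq enum_rank_inj). Qed.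

(** For an orthonormal basis [Q] of the row space of [M], the projection is [Q^t* *m Q]; its squared
    Hilbert-Schmidt norm equals its trace. *)
Lemma orthogonal_projection M : exists P : 'M[C]_#|T|,
  [/\ P^t* = P, P *m P = P, M *m P = M & \sum_x \sum_y `|kmx P x y| ^+ 2 = (\rank M)%:R].
Proof.
pose Q := schmidt (row_base M).
have UQ : Q *m Q^t* = 1%:M by apply/unitarymxP/schmidt_unitarymx/rank_leq_col.
have /submxP[D ME] : (M <= Q)%MS by rewrite -(eq_row_base M) schmidt_sub.
pose P := Q^t* *m Q.
have PH : P^t* = P by rewrite adjmxM trmxCK.
have PP : P *m P = P by rewrite /P !mulmxA -(mulmxA _ Q) UQ mulmx1.
exists P; split=> //.
  by rewrite ME /P mulmxA -(mulmxA D) UQ mulmx1.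
transitivity (\tr P).
  rewrite /mxtrace sum_enum_rank; apply: eq_bigr => x _.
  transitivity ((P *m P^t*) (enum_rank x) (enum_rank x)); last by rewrite PH PP.
  rewrite mxE sum_enum_rank; apply: eq_bigr => y _.
  by rewrite normCK; congr (_ * _); rewrite mxE; congr (_^*); rewrite mxE.
by rewrite /P mxtrace_mulC UQ mxtrace1.
Qed.

End KernelMatrix.

Section PowerBound.
Variables (C : numClosedFieldType) (k : nat) (n : 'I_k -> nat) (m : nat).

(** On each leg [1 - G] maps into [B], [word_power m g] preserves [B], and [1 - P] kills it, so a
    factor [G] may be inserted before [word_power m g *m (1 - P)]. As [G] annihilates the power of
    [X], so does the product of all complements after [g], and [nrm2_le_legs] leaves only the parts
    inside some [B i]. *)
Lemma nrm2_power_le (X : mindex (fun i => 'I_(n i)) -> C) (g : forall i, 'M[C]_(n i))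
    (B G : forall i, 'M[C]_#|{: word (n i) m}|) (c : 'I_k -> C) :
    (forall i, 0 <= c i) ->
    (forall i, leg_bound (tens g X) i (c i)) ->
    (forall i, B i *m word_power m (g i) <= B i)%MS ->
    (forall i, 1%:M - G i <= B i)%MS ->
    (forall w, tens (fun i => kmx (G i)) (@xpow C k n m X) w = 0) ->
  nrm2 (tens g X) ^+ m <= \sum_i (\rank (B i))%:R * c i ^+ m.
Proof.
move=> c0 bX stB GB G0.
pose Pr i := cid (orthogonal_projection (B i)); pose P i := projT1 (Pr i).
have PH i : (P i)^t* = P i by case: (projT2 (Pr i)).
have PP i : P i *m P i = P i by case: (projT2 (Pr i)).
have BP i : B i *m P i = B i by case: (projT2 (Pr i)).
have trP i : \sum_x \sum_y `|kmx (P i) x y| ^+ 2 = (\rank (B i))%:R by case: (projT2 (Pr i)).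
rewrite -(@nrm2_xpow C k n m).
apply: le_trans (@nrm2_le_legs _ _ _ (fun i => kmx (P i)) _ _ _ _) _.
- by move=> i x y; rewrite kmx_gram PH PP.
- by move=> i x y; rewrite /kmx -{1}PH !mxE.
- move=> w.
  have factor i : word_power m (g i) *m (1%:M - P i) =
      G i *m (word_power m (g i) *m (1%:M - P i)).
    apply/eqP; rewrite -subr_eq0 -{1}[word_power m (g i)]mul1mx -!mulmxA -mulmxBl.
    have /submxP[D ->] := GB i.
    have /submxP[E BE] := stB i.
    by rewrite -mulmxA (mulmxA (B i)) BE -mulmxA mulmxBr mulmx1 BP subrr !mulmx0.
  have xE v : @xpow C k n m (tens g X) v =
      tens (fun i => kmx (word_power m (g i))) (@xpow C k n m X) v.
    rewrite xpow_tens; apply: eq_tens => // i x y.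
    by rewrite /kmx mxE !enum_rankK.
  rewrite (eq_tens _ (fun i => @kcompl_kmx _ _ (P i)) xE) tens_comp.
  rewrite (eq_tens (N := fun i => kmul (kmx (G i)) (kmx (word_power m (g i) *m (1%:M - P i)))) (Y := @xpow C k n m X)) //.
    by rewrite -tens_comp {1}/tens big1 // => v _; rewrite G0 mul0r.
  by move=> i x y; rewrite !kmx_mul -factor.
apply: ler_sum => i _; apply: le_trans (nrm2_tens_leg _ (@leg_bound_xpow C k n m _ _ _ (c0 i) (bX i))) _.
by rewrite trP mulrC.
Qed.

End PowerBound.

(** * Entropy and types *)

Section Entropy.
Variable R : realType.
Local Notation ln2 := (ln (2 : R)).

Lemma ln2_gt0 : 0 < ln2.
Proof. by rewrite ln_gt0 // ltr1n. Qed.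

Lemma ln_sub1 (x : R) : 0 < x -> ln x <= x - 1.
Proof.
move=> x0; have := @le_ln1Dx _ (x - 1); rewrite (addrC 1) subrK; apply.
by rewrite ltrBrDr addNr.
Qed.

(** The inequality [ln x <= x - 1] at [x = 1 / sqrt z] gives [z * ln z >= 2 * z - 2 * sqrt z], which
    is the left side. *)
Lemma mul_ln_ge (z : R) : 0 <= z -> z - 1 + (Num.sqrt z - 1) ^+ 2 <= z * ln z.
Proof.
rewrite le_eqVlt => /orP[/eqP<-|z0]; first by rewrite sqrtr0 mul0r; nra.
have s0 : 0 < Num.sqrt z by rewrite sqrtr_gt0.
have zE := sqr_sqrtr (ltW z0); set s := Num.sqrt z in s0 zE *.
have lz : ln z = - (ln s^-1 *+ 2).
  by rewrite -zE lnXn // lnV ?posrE // mulNrn opprK.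
have := @ln_sub1 s^-1; rewrite invr_gt0 => /(_ s0) le.
have : s ^+ 2 * ln s^-1 <= s ^+ 2 * (s^-1 - 1) by apply: ler_wpM2l => //; rewrite sqr_ge0.
have -> : s ^+ 2 * (s^-1 - 1) = s - s ^+ 2 by field; lra.
rewrite lz -zE mulr2n; nra.
Qed.

Lemma sqr_dev_le (z n : R) : 0 <= z -> z <= n ->
  (z - 1) ^+ 2 <= 2 * (n + 1) * (Num.sqrt z - 1) ^+ 2.
Proof.
move=> z0 zn; have zE := sqr_sqrtr z0; have s0 := sqrtr_ge0 z.
set s := Num.sqrt z in s0 zE *; rewrite -zE.
have -> : (s ^+ 2 - 1) ^+ 2 = (s + 1) ^+ 2 * (s - 1) ^+ 2 by ring.
apply: ler_wpM2r; first exact: sqr_ge0.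
have : s ^+ 2 <= n by rewrite zE.
have := sqr_ge0 (s - 1); nra.
Qed.

Lemma dist_le1 (T : finType) (p : T -> R) : is_dist p -> forall x, p x <= 1.
Proof.
by move=> [p0 <-] x; rewrite (bigD1 x) //= lerDl sumr_ge0.
Qed.

(** [mul_ln_ge] and [sqr_dev_le] at [z = #|T| * p x], summed over [x]. The correction is a
    polynomial in [p] that vanishes only at the uniform distribution, a convenient quantity to
    minimize on a compact set. *)
Lemma entropy_deficit (T : finType) (p : T -> R) : is_dist p ->
  entropy p + (\sum_x (#|T|%:R * p x - 1) ^+ 2) / (2 * #|T|%:R * (#|T|%:R + 1) * ln2)
    <= log2 #|T|%:R.
Proof.
move=> [p0 p1]; set n := #|T|%:R : R.
have T0 : (0 < #|T|)%N.
  rewrite lt0n; apply/eqP => T0; have := oner_neq0 R; rewrite -p1 big_pred0 ?eqxx // => x.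
  by have := fintype0 x T0.
have n0 : 0 < n by rewrite ltr0n.
have l2 := ln2_gt0.
have key x : p x - n^-1 + (n * p x - 1) ^+ 2 / (2 * n * (n + 1)) <= p x * ln (p x) + p x * ln n.
  have np0 : 0 <= n * p x by rewrite mulr_ge0 // ltW.
  have npn : n * p x <= n by rewrite ler_piMr ?dist_le1 // ltW.
  have h1 := mul_ln_ge np0; have h2 := sqr_dev_le np0 npn.
  have -> : p x * ln (p x) + p x * ln n = (n * p x * ln (n * p x)) / n.
    have [->|px] := eqVneq (p x) 0; first by rewrite mulr0 !mul0r addr0.
    have px0 : 0 < p x by rewrite lt_neqAle eq_sym px p0.
    by rewrite lnM ?posrE //; field; lra.
  rewrite ler_pdivlMr //.
  apply: le_trans h1; have n10 : 0 < 2 * (n + 1) by lra.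
  have -> : (p x - n^-1 + (n * p x - 1) ^+ 2 / (2 * n * (n + 1))) * n =
      n * p x - 1 + (n * p x - 1) ^+ 2 / (2 * (n + 1)) by field; lra.
  by rewrite lerD2l ler_pdivrMr // [leRHS]mulrC.
have : \sum_x (p x - n^-1 + (n * p x - 1) ^+ 2 / (2 * n * (n + 1))) <=
    \sum_x (p x * ln (p x) + p x * ln n) by apply: ler_sum => x _; apply: key.
rewrite !big_split /= p1 sumr_const -!mulr_suml p1 mul1r.
rewrite -[_ *+ #|T|]mulr_natl -/n mulrN mulfV ?(gt_eqF n0) // subrr add0r => le.
rewrite /entropy /log2 -(ler_pM2r l2) mulrDl divfK ?gt_eqF // mulNr.
have -> : (\sum_x p x * (ln (p x) / ln2)) * ln2 = \sum_x p x * ln (p x).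
  by rewrite mulr_suml; apply: eq_bigr => x _; rewrite mulrA divfK ?gt_eqF.
rewrite addrC lerBlDl; apply: le_trans le.
by rewrite le_eqVlt; apply/orP; left; apply/eqP; field; lra.
Qed.

Lemma entropy_le (T : finType) (p : T -> R) : is_dist p -> entropy p <= log2 #|T|%:R.
Proof.
move=> dp; apply: le_trans (entropy_deficit dp); rewrite lerDl.
rewrite divr_ge0 ?sumr_ge0 // => [x _|]; first exact: sqr_ge0.
by rewrite !mulr_ge0 // ?addr_ge0 // ltW // ln2_gt0.
Qed.

Lemma entropy_ge0 (T : finType) (p : T -> R) : is_dist p -> 0 <= entropy p.
Proof.
move=> dp; rewrite /entropy -sumrN sumr_ge0 // => x _.
have [p0 _] := dp.
rewrite -mulrN mulr_ge0 // /log2 -mulNr divr_ge0 ?(ltW ln2_gt0) // oppr_ge0.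
by rewrite ln_le0 // dist_le1.
Qed.

End Entropy.

Section Types.
Variables (R : realType) (n m : nat).
Hypothesis m0 : (0 < m)%N.

Definition letter_count (w : word n m) (i : 'I_n) : nat := #|[pred l | w l == i]|.

Definition word_type (w : word n m) (i : 'I_n) : R := (letter_count w i)%:R / m%:R.

Lemma sum_letter_count w : (\sum_i letter_count w i)%N = m.
Proof.
rewrite -[RHS]card_ord -[RHS]sum1_card (partition_big w xpredT) //=.
by apply: eq_bigr => i _; rewrite /letter_count -sum1_card; apply: eq_bigl.
Qed.

Lemma word_type_dist w : is_dist (word_type w).
Proof.
split=> [i|]; first by rewrite divr_ge0.
by rewrite -mulr_suml -natr_sum sum_letter_count divff // pnatr_eq0 -lt0n.
Qed.

Lemma letter_count_place w s : letter_count (place_word w s) =1 letter_count w.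
Proof.
move=> i; rewrite /letter_count -!sum1_card [RHS](reindex_inj (@perm_inj _ s^-1%g)).
by apply: eq_bigl => l; rewrite !inE ffunE.
Qed.

Lemma prod_word_type w : \prod_l word_type w (w l) =
  expR (- (m%:R * ln 2 * entropy (word_type w))).
Proof.
have wt l : 0 < word_type w (w l).
  by rewrite divr_gt0 ?ltr0n //; apply/card_gt0P; exists l; rewrite inE eqxx.
transitivity (\prod_l expR (ln (word_type w (w l)))).
  by apply: eq_bigr => l _; rewrite lnK ?posrE.
rewrite -expR_sum; congr expR.
rewrite (partition_big w xpredT) //= /entropy mulrN opprK mulr_sumr.
apply: eq_bigr => i _.
rewrite (eq_bigr (fun=> ln (word_type w i))) => [|l /eqP->//].
rewrite sumr_const -/(letter_count w i) -mulr_natl /log2 /word_type.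
have l2 := ln2_gt0 R; have mR : 0 < m%:R :> R by rewrite ltr0n.
field; lra.
Qed.

(** All words of one type [p] have probability [2^(-m H(p))] under the product distribution of [p],
    so there are at most [2^(m H(p))] of them; the number of types is at most [(m+1)^n]. *)
Lemma card_low_entropy_words (a : R) :
  #|[pred w | `[< entropy (word_type w) < a >]]|%:R <=
    (m.+1 ^ n)%:R * expR (m%:R * ln 2 * a).
Proof.
pose ty (w : word n m) : {ffun 'I_n -> 'I_m.+1} := [ffun i => inord (letter_count w i)].
have tyE w w' : ty w = ty w' -> letter_count w =1 letter_count w'.
  move=> e i; have /(congr1 val) := congr1 (fun t : {ffun 'I_n -> 'I_m.+1} => t i) e.
  by rewrite !ffunE /= !inordK // ltnS -[leqRHS](card_ord m) max_card.
rewrite -sum1_card natr_sum (partition_big ty xpredT) //=.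
rewrite -[X in (_ ^ X)%N]card_ord -[X in (X ^ _)%N]card_ord -card_ffun -sum1_card natr_sum mulr_suml.
apply: ler_sum => t _; rewrite mul1r.
have [[w0 /andP[/asboolP e0 /eqP t0]]|none] := pselect (exists w, `[< entropy (word_type w) < a >] && (ty w == t)); last first.
  rewrite big_pred0 ?expR_ge0 // => w; apply/negP => h; apply: none; exists w.
  by rewrite inE in h.
have q : \sum_(w : word n m) \prod_l word_type w0 (w l) = 1.
  rewrite -(bigA_distr_bigA (fun _ => word_type w0)) /=.
  by apply: big1 => l _; case: (word_type_dist w0).
rewrite -[leRHS]mul1r -[X in _ <= X * _]q mulr_suml.
rewrite [leRHS](bigID (fun w => w \in [pred w | `[< entropy (word_type w) < a >] && (ty w == t)])) /=.
rewrite -[leLHS]addr0 lerD //; last first.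
  by apply: sumr_ge0 => w _; rewrite mulr_ge0 ?expR_ge0 // prodr_ge0 // => l _; case: (word_type_dist w0).
apply: ler_sum => w; rewrite inE => /andP[/asboolP ew /eqP tw].
have wt : word_type w =1 word_type w0.
  by move=> i; rewrite /word_type (tyE w w0) // tw t0.
rewrite -(eq_bigr _ (fun l _ => wt (w l))) prod_word_type -expRD -[leLHS](@expR0 R) ler_expR.
rewrite addrC subr_ge0; apply: ler_wpM2l; last exact: ltW.
by rewrite mulr_ge0 // ltW // ln2_gt0.
Qed.

Lemma entropy_normalized_partition la (w : word n m) :
    is_partition m la -> tab_row la =1 word_nat w ->
  entropy (@normalized_partition R m la) = entropy (word_type w).
Proof.
case/and3P => _ la0 /eqP lam tw; rewrite /entropy; congr (- _).
pose F i : R := (nth 0%N la i)%:R / m%:R * log2 ((nth 0%N la i)%:R / m%:R).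
transitivity (\sum_(i < size la) F i); first by [].
have sz : (size la <= n)%N.
  rewrite leqNgt; apply/negP => lt.
  have [|e re _] := @tab_cell m la lam n 0.
    by rewrite lt0n; apply: contraNneq la0 => <-; apply: mem_nth.
  by have := ltn_ord (w e); rewrite -[X in (X < _)%N](tw e) re ltnn.
rewrite (big_ord_widen n F sz) big_mkcond; apply: eq_bigr => i _ /=.
have -> : word_type w i = (nth 0%N la i)%:R / m%:R.
  rewrite /word_type /letter_count -(tab_row_card lam); congr (_%:R / _).
  by apply: eq_card => l; rewrite !inE tw.
case: ltnP => // le; by rewrite nth_default // !mul0r.
Qed.

End Types.

Section Asymptotics.
Variable R : realType.

Lemma poly_expR_small (D : nat) (K eta : R) : 0 <= K -> 0 < eta ->
  exists2 m, (0 < m)%N & K * m.+1%:R ^+ D * expR (- (m%:R * eta)) < 1.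
Proof.
move=> K0 eta0.
(* Chosen so that [c < m] makes [K * (2 * m) ^ D] smaller than the term of degree [D + 1] in the
   exponential series at [m * eta]. *)
pose c := K * 2 ^+ D * (D.+1)`!%:R / eta ^+ D.+1.
have c0 : 0 <= c by rewrite !mulr_ge0 ?invr_ge0 ?exprn_ge0 // ltW.
pose m := (Num.truncn c).+1.
have mc : c < m%:R by rewrite truncnS_gt.
have mR : 1 <= m%:R :> R by rewrite ler1n.
exists m => //; rewrite expRN ltr_pdivrMr ?expR_gt0 // mul1r.
have me : 0 <= m%:R * eta by rewrite mulr_ge0 // ltW.
have h := @expR_ge1Dxn _ (m%:R * eta) D me.
apply: lt_le_trans h; apply: (@le_lt_trans _ _ (K * (2 * m%:R) ^+ D)).
  apply: ler_wpM2l => //; rewrite lerXn2r ?nnegrE ?mulr_ge0 // -natr1; lra.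
apply: (@le_lt_trans _ _ ((m%:R * eta) ^+ D.+1 / (D.+1)`!%:R)); last by rewrite ltrDr.
rewrite ler_pdivlMr ?ltr0n ?fact_gt0 // !exprMn exprS.
have eD : 0 < eta ^+ D.+1 by rewrite exprn_gt0.
have mD : 0 <= m%:R ^+ D :> R by rewrite exprn_ge0.
move: mc; rewrite ltr_pdivrMr // => /ltW mc.
have := ler_wpM2r mD mc.
by rewrite /c; lra.
Qed.

End Asymptotics.

(** * Lower bound on the norm over determinant-one tuples *)

Section RealContinuity.
Variables (R : realType) (T : topologicalType).
Implicit Types F G : T -> R.

Lemma rcont_cst (a : R) : continuous (fun _ : T => a).
Proof. exact: cst_continuous. Qed.

Lemma rcontD F G : continuous F -> continuous G -> continuous (fun f => F f + G f).
Proof. by move=> cF cG f; exact: (@continuousD R R^o T F G f (cF f) (cG f)). Qed.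

Lemma rcontN F : continuous F -> continuous (fun f => - F f).
Proof. by move=> cF f; exact: (@continuousN R R^o T F f (cF f)). Qed.

Lemma rcontM F G : continuous F -> continuous G -> continuous (fun f => F f * G f).
Proof. by move=> cF cG f; exact: (@continuousM R T F G f (cF f) (cG f)). Qed.

Lemma rcont_sqr F : continuous F -> continuous (fun f => F f ^+ 2).
Proof. by move=> cF; apply: rcontM. Qed.

Lemma rcont_min F G : continuous F -> continuous G -> continuous (fun f => Num.min (F f) (G f)).
Proof. by move=> cF cG f; exact: (@continuous_min R T F G f (cF f) (cG f)). Qed.

Lemma rcont_sum (J : Type) (s : seq J) (P : pred J) (F : J -> T -> R) :
  (forall j, continuous (F j)) -> continuous (fun f => \sum_(j <- s | P j) F j f).
Proof.
move=> cF; elim: s => [|j s IH].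
  by under [fun f => _]funext => f do rewrite big_nil; apply: rcont_cst.
under [fun f => _]funext => f do rewrite big_cons.
by case: (P j) => //; apply: rcontD.
Qed.

Lemma rcont_prod (J : Type) (s : seq J) (P : pred J) (F : J -> T -> R) :
  (forall j, continuous (F j)) -> continuous (fun f => \prod_(j <- s | P j) F j f).
Proof.
move=> cF; elim: s => [|j s IH].
  by under [fun f => _]funext => f do rewrite big_nil; apply: rcont_cst.
under [fun f => _]funext => f do rewrite big_cons.
by case: (P j) => //; apply: rcontM.
Qed.

Implicit Types Z W : T -> R[i].

Definition ccont Z := continuous (fun f => complex.Re (Z f)) /\ continuous (fun f => complex.Im (Z f)).

Lemma ccont_cst z : ccont (fun=> z).
Proof. by split; apply: rcont_cst. Qed.

Lemma ccontD Z W : ccont Z -> ccont W -> ccont (fun f => Z f + W f).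
Proof.
move=> [rZ iZ] [rW iW]; split.
  under [fun f => _]funext => f do rewrite raddfD.
  exact: rcontD.
under [fun f => _]funext => f do rewrite raddfD.
exact: rcontD.
Qed.

Lemma ccontM Z W : ccont Z -> ccont W -> ccont (fun f => Z f * W f).
Proof.
move=> [rZ iZ] [rW iW]; split.
  have -> : (fun f => complex.Re (Z f * W f)) = fun f =>
      complex.Re (Z f) * complex.Re (W f) + - (complex.Im (Z f) * complex.Im (W f)).
    by apply/funext => f; case: (Z f) (W f) => [? ?] [? ?].
  by apply: rcontD; [|apply: rcontN]; apply: rcontM.
have -> : (fun f => complex.Im (Z f * W f)) = fun f =>
    complex.Re (Z f) * complex.Im (W f) + complex.Im (Z f) * complex.Re (W f).
  by apply/funext => f; case: (Z f) (W f) => [? ?] [? ?].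
by apply: rcontD; apply: rcontM.
Qed.

Lemma ccont_conj Z : ccont Z -> ccont (fun f => (Z f)^*).
Proof.
move=> [rZ iZ]; split.
  by have -> : (fun f => complex.Re (Z f)^*) = fun f => complex.Re (Z f);
    first by apply/funext => f; case: (Z f).
have -> : (fun f => complex.Im (Z f)^*) = fun f => - complex.Im (Z f).
  by apply/funext => f; case: (Z f).
exact: rcontN.
Qed.

Lemma ccont_sum (J : Type) (s : seq J) (P : pred J) (Z : J -> T -> R[i]) :
  (forall j, ccont (Z j)) -> ccont (fun f => \sum_(j <- s | P j) Z j f).
Proof.
move=> cZ; elim: s => [|j s IH].
  by under [fun f => _]funext => f do rewrite big_nil; apply: ccont_cst.
under [fun f => _]funext => f do rewrite big_cons.
by case: (P j) => //; apply: ccontD.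
Qed.

Lemma ccont_prod (J : Type) (s : seq J) (P : pred J) (Z : J -> T -> R[i]) :
  (forall j, ccont (Z j)) -> ccont (fun f => \prod_(j <- s | P j) Z j f).
Proof.
move=> cZ; elim: s => [|j s IH].
  by under [fun f => _]funext => f do rewrite big_nil; apply: ccont_cst.
under [fun f => _]funext => f do rewrite big_cons.
by case: (P j) => //; apply: ccontM.
Qed.

(** The squared modulus with values in [R], as required for minima and logarithms. *)
Definition sqn (z : R[i]) : R := complex.Re z ^+ 2 + complex.Im z ^+ 2.

Lemma rcont_sqn Z : ccont Z -> continuous (fun f => sqn (Z f)).
Proof.
by move=> [rZ iZ]; apply: rcontD; apply: rcont_sqr.
Qed.

End RealContinuity.

Section BoxMinimum.
Variables (R : realType) (I : finType).
Local Notation fn := {ptws I -> R}.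
Implicit Types F h : fn -> R.

Lemma rcont_proj i : continuous (fun f : fn => f i).
Proof. exact: (@proj_continuous I (fun=> R)). Qed.

Lemma box_min F h : continuous F -> continuous h ->
    (forall f, (forall i, `|f i| <= 1) -> h f = 0 -> 0 < F f) ->
  exists2 mu, 0 < mu & forall f, (forall i, `|f i| <= 1) -> h f = 0 -> mu <= F f.
Proof.
move=> cF ch pos.
pose box := [set f : fn | forall i, `[-1, 1]%classic (f i)]%classic.
pose K := (box `&` [set f | h f = 0])%classic.
have cbox : compact box.
  exact: (@tychonoff I (fun=> R) (fun=> `[-1, 1]%classic)
  (fun=> @segment_compact R (-1) 1)).
have cK : compact K.
  rewrite /K; apply: compact_closedI => //.
  exact: ((continuous_closedP h).1 ch _ (@closed_eq R 0)).
have boxP f : (forall i, `|f i| <= 1) -> box f.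
  by move=> b i /=; rewrite in_itv /= -ler_norml.
have [[f0 Kf0]|none] := pselect (exists f, K f); last first.
  exists 1 => // f /boxP bf hf; case: none; by exists f.
have [c cK' min] := @compact_EVT_min _ R F K (ex_intro _ f0 Kf0) cK
  (continuous_subspaceT cF).
have Kc : K c by apply: set_mem.
exists (F c) => [|f /boxP bf hf]; last by apply: min; apply: mem_set; split.
case: Kc => bc hc; apply: pos => // i; have := bc i.
by rewrite /= in_itv /= -ler_norml.
Qed.

End BoxMinimum.

(** * Supports with a uniform point *)

Section Support.
Variables (R : realType) (k : nat) (n : 'I_k -> nat) (theta : 'I_k -> R).
Hypothesis theta_dist : is_dist theta.
Hypothesis theta_gt0 : forall i, 0 < theta i.
Local Notation W := (multi_index n).

Definition max_exponent : R := \sum_i theta i * log2 (n i)%:R.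

(* The uniform point lies in the moment polytope spanned by S. *)
Definition uniform_support (S : {set W}) : Prop :=
  exists2 P : W -> R, is_dist_on S P & forall i x, marginal P (x : 'I_(n i)) = (n i)%:R^-1.

Lemma marginal_dist (P : W -> R) i : is_dist P -> is_dist (@marginal R k n P i).
Proof.
move=> [P0 P1]; split=> [x|]; first by apply: sumr_ge0.
by rewrite -P1 [RHS](partition_big (fun a : W => a i) xpredT).
Qed.

Lemma weighted_entropy_le (P : W -> R) : is_dist P ->
  \sum_i theta i * entropy (@marginal R k n P i) <= max_exponent.
Proof.
move=> dP; apply: ler_sum => i _; apply: ler_wpM2l; first exact: ltW.
by apply: le_trans (entropy_le (marginal_dist i dP)) _; rewrite card_ord.
Qed.

(** Makes the infimum in [support_exponent] one of a set bounded below; if [S] carries no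
    distribution, the [sup] is the default [0]. *)
Lemma max_support_entropy_ge0 (S : {set W}) : 0 <= max_support_entropy theta S.
Proof.
rewrite /max_support_entropy; set A := (X in sup X).
have [[h Ah]|none] := pselect (exists h, A h); last first.
  by rewrite sup_out // => -[[h Ah] _]; apply: none; exists h.
have ub : has_ubound A.
  by exists max_exponent => _ [P [dP _] ->]; apply: weighted_entropy_le.
apply: le_trans (ub_le_sup ub Ah); case: Ah => P [dP _] ->.
by apply: sumr_ge0 => i _; rewrite mulr_ge0 ?(ltW (theta_gt0 i)) ?entropy_ge0 //; apply: marginal_dist.
Qed.

(** Distributions on [S] are parametrized by squares, which makes nonnegativity automatic and leaves
    a closed condition on a box. The deficit is at least [F], whose minimum is positive because
    [F f = 0] would make all marginals uniform. *)
Lemma max_support_entropy_lt (S : {set W}) : S != finset.set0 -> ~ uniform_support S ->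
  max_support_entropy theta S < max_exponent.
Proof.
move=> /set0Pn[a0 Sa0] nu.
pose P (f : W -> R) (a : W) : R := if a \in S then f a * f a else 0.
pose dev (Q : W -> R) i := \sum_(x : 'I_(n i)) ((n i)%:R * marginal Q x - 1) ^+ 2.
pose den i := 2 * (n i)%:R * ((n i)%:R + 1) * ln 2 : R.
have n_gt0 i : 0 < (n i)%:R :> R by rewrite ltr0n (leq_ltn_trans (leq0n _) (ltn_ord (a0 i))).
have den0 i : 0 < den i by rewrite !mulr_gt0 ?ln2_gt0 ?addr_gt0.
have dev0 Q i : 0 <= dev Q i by apply: sumr_ge0 => x _; apply: sqr_ge0.
pose F (f : W -> R) := \sum_i theta i / den i * dev (P f) i.
pose h (f : W -> R) := \sum_a P f a - 1.
have cP a : continuous ((fun f => P f a) : {ptws W -> R} -> R).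
  rewrite /P; case: (a \in S); last exact: rcont_cst.
  by apply: rcontM; apply: rcont_proj.
have cF : continuous (F : {ptws W -> R} -> R).
  apply: rcont_sum => i; apply: rcontM; first exact: rcont_cst.
  apply: rcont_sum => x; apply: rcont_sqr; apply: rcontD; last exact: rcont_cst.
  by apply: rcontM; [apply: rcont_cst|apply: rcont_sum].
have ch : continuous (h : {ptws W -> R} -> R).
  by apply: rcontD; [apply: rcont_sum|apply: rcont_cst].
have P_dist f : h f = 0 -> is_dist_on S (P f).
  move=> /eqP; rewrite subr_eq0 => /eqP e; split; last by move=> a /negPf; rewrite /P => ->.
  by split=> // a; rewrite /P; case: ifP => // _; rewrite -expr2 sqr_ge0.
have pos f : (forall a, `|f a| <= 1) -> h f = 0 -> 0 < F f.
  move=> _ hf; rewrite lt_neqAle eq_sym; apply/andP; split; last first.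
    by apply: sumr_ge0 => i _; rewrite mulr_ge0 ?divr_ge0 // ltW.
  apply/eqP => F0; apply: nu; exists (P f); first exact: P_dist.
  move=> i x; move/eqP: F0; rewrite psumr_eq0 => [/allP/(_ i)|j _]; last first.
    by rewrite mulr_ge0 ?divr_ge0 // ltW.
  rewrite mem_index_enum mulf_eq0 gt_eqF ?divr_gt0 //= => /(_ isT).
  rewrite psumr_eq0 => [/allP/(_ x)|y _]; last exact: sqr_ge0.
  rewrite mem_index_enum sqrf_eq0 subr_eq0 => /(_ isT)/eqP e.
  by apply: (mulfI (lt0r_neq0 (n_gt0 i))); rewrite e mulfV // gt_eqF.
have [mu mu0 muF] := box_min cF ch pos.
apply: (@le_lt_trans _ _ (max_exponent - mu)); last by rewrite ltrBlDr ltrDl.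
rewrite /max_support_entropy; apply: ge_sup.
  exists (\sum_i theta i * entropy (@marginal R k n (fun a => (a == a0)%:R) i)).
  exists (fun a => (a == a0)%:R) => //; split; last by move=> a; apply: contraNeq; rewrite pnatr_eq0 eqb0 negbK => /eqP->.
  split=> [a|]; first exact: ler0n.
  by rewrite (bigD1 a0) //= eqxx big1 ?addr0 // => a /negPf->.
move=> _ [Q [dQ QS] ->].
pose f a := Num.sqrt (Q a).
have Q0 : forall a, 0 <= Q a by case: dQ.
have PQ : P f = Q.
  apply/funext => a; rewrite /P /f -expr2 sqr_sqrtr //.
  by case: ifP => // /negbT/QS->.
have box a : `|f a| <= 1.
  by rewrite ger0_norm ?sqrtr_ge0 // -[leRHS]sqrtr1 ler_wsqrtr // dist_le1.
have hf : h f = 0 by rewrite /h PQ; case: dQ => _ ->; rewrite subrr.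
have := muF f box hf; rewrite lerBrDr => /(lerD (lexx (\sum_i theta i * entropy (@marginal R k n Q i)))).
move/le_trans; apply; rewrite /F PQ -big_split /=; apply: ler_sum => i _.
rewrite -mulrA -mulrDr; apply: ler_wpM2l; first exact: ltW.
have := entropy_deficit (marginal_dist i dQ); rewrite card_ord.
by rewrite /dev /den [_^-1 * _]mulrC.
Qed.

Lemma prod_powR_max_exponent : (forall i, (0 < n i)%N) ->
  \prod_i ((n i)%:R `^ theta i) = 2 `^ max_exponent.
Proof.
move=> n0; rewrite /powR pnatr_eq0 /= /max_exponent mulr_suml expR_sum.
apply: eq_bigr => i _; rewrite pnatr_eq0 -[_ == _]negbK -lt0n n0 /=.
by rewrite -mulrA /log2 divfK // gt_eqF // ln2_gt0.
Qed.

Lemma uniform_support_of_exponent (t c : tensor R n) (C : forall i, 'M[R[i]]_(n i)) :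
    t != 0 -> max_exponent <= support_exponent theta t ->
    is_bases C -> is_coordinates C t c ->
  uniform_support (tensor_supp c).
Proof.
move=> t0 le bC cC; apply: contrapT => nu; move: le; apply/negP; rewrite -ltNge.
apply: le_lt_trans (max_support_entropy_lt (S := tensor_supp c) _ nu).
  apply: ge_inf; last by exists C, c.
  by exists 0 => _ [C' [c' [_ _ ->]]]; apply: max_support_entropy_ge0.
apply: contraNneq t0 => S0; apply/eqP/ffunP => b; rewrite cC ffunE big1 // => a _.
have : a \notin tensor_supp c by rewrite S0 inE.
by rewrite inE negbK => /eqP->; rewrite mul0r.
Qed.

End Support.

Lemma ln_prod (R : realType) (I : Type) (r : seq I) (P : pred I) (f : I -> R) :
  (forall i, P i -> 0 < f i) -> ln (\prod_(i <- r | P i) f i) = \sum_(i <- r | P i) ln (f i).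
Proof.
move=> f0; suff [] : 0 < \prod_(i <- r | P i) f i /\
  ln (\prod_(i <- r | P i) f i) = \sum_(i <- r | P i) ln (f i) by [].
elim/big_rec2: _ => [|i x y Pi [y0 <-]]; first by rewrite ltr01 ln1.
by rewrite mulr_gt0 ?f0 // lnM ?posrE ?f0.
Qed.

Section NormLowerBound.
Variables (R : realType) (k : nat) (n : 'I_k -> nat).
Local Notation W := (multi_index n).
Local Notation C := R[i].
Local Open Scope complex_scope.
Local Open Scope ring_scope.

Lemma normCsqn (z : C) : `|z| ^+ 2 = (sqn z)%:C.
Proof. by rewrite -add_Re2_Im2. Qed.

Lemma sqn_ge0 (z : C) : 0 <= sqn z.
Proof. by rewrite addr_ge0 ?sqr_ge0. Qed.

Lemma sqn_eq0 (z : C) : (sqn z == 0) = (z == 0).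
Proof. by rewrite -(inj_eq (@complexI R)) -normCsqn sqrf_eq0 normr_eq0. Qed.

(* Weighted AM-GM: d scales coordinate a by a factor whose weighted geometric mean
   over a uniform P is 1. *)
Lemma uniform_support_amgm (S : {set W}) (d : forall i, 'I_(n i) -> R) (s : W -> R) :
    (forall i x, 0 < d i x) -> (forall i, \prod_x d i x = 1) -> (forall a, 0 <= s a) ->
    uniform_support R S ->
  \prod_(a in S) Num.min 1 (s a) <= \sum_(a : W) (\prod_i d i (a i)) * s a.
Proof.
move=> d0 d1 s0 [P [[P0 P1] PS] PU].
pose z (a : W) := (\prod_i d i (a i)) * s a; pose Z := \sum_a z a.
have dp (a : W) : 0 < \prod_i d i (a i) by apply: prodr_gt0.
have z0 a : 0 <= z a by rewrite mulr_ge0 // ltW.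
have Z0 : 0 <= Z by apply: sumr_ge0.
have [[a Sa sa]|pos] := pselect (exists2 a, a \in S & s a = 0).
  by rewrite (bigD1 a) //= sa minEle ler10 mul0r.
have {}pos a : a \in S -> 0 < s a.
  move=> Sa; rewrite lt_neqAle s0 andbT eq_sym; apply/eqP => sa.
  by apply: pos; exists a.
have zS a : a \in S -> 0 < z a by move=> Sa; rewrite mulr_gt0 ?pos.
have [a1 Sa1] : exists a, a \in S.
  apply: contrapT => none; have := oner_neq0 R; rewrite -P1 big1 ?eqxx // => a _.
  by apply: PS; apply/negP => Sa; apply: none; exists a.
have Zp : 0 < Z by rewrite /Z (bigD1 a1) //= ltr_pwDl ?zS // sumr_ge0.
have PleS a : P a <= 1 by apply: dist_le1.
(* Jensen's inequality, from [ln y <= y - 1] at [y = z a / Z] averaged over [P]. *)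
have geo : \sum_a P a * ln (z a) <= ln Z.
  have : \sum_a P a * (ln (z a) - ln Z) <= \sum_a (z a / Z - P a).
    apply: ler_sum => a _; have [Sa|nSa] := boolP (a \in S); last first.
      by rewrite (PS _ nSa) mul0r subr0 divr_ge0.
    rewrite -ln_div ?posrE ?zS //.
    apply: (@le_trans _ _ (P a * (z a / Z - 1))).
      by apply: ler_wpM2l => //; apply: ln_sub1; rewrite divr_gt0 ?zS.
    rewrite mulrBr mulr1 lerD2r ler_piMl // divr_ge0 //.
  rewrite sumrB P1 -mulr_suml divff ?gt_eqF // subrr.
  under eq_bigr do rewrite mulrBr.
  by rewrite sumrB -mulr_suml P1 mul1r subr_le0.
have split_ln : \sum_a P a * ln (z a) = \sum_a P a * ln (s a).
  have lnE a : P a * ln (z a) = P a * \sum_i ln (d i (a i)) + P a * ln (s a).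
    have [Sa|nSa] := boolP (a \in S); last by rewrite (PS _ nSa) !mul0r addr0.
    rewrite -mulrDr /z lnM ?posrE ?pos //; congr (_ * (_ + _)).
    by rewrite ln_prod.
  rewrite (eq_bigr _ (fun a _ => lnE a)) big_split /= -[RHS]add0r; congr (_ + _).
  under eq_bigr do rewrite mulr_sumr.
  rewrite exchange_big big1 // => i _ /=.
  rewrite (partition_big (fun a : W => a i) xpredT) //=.
  transitivity (\sum_x (n i)%:R^-1 * ln (d i x)).
    apply: eq_bigr => x _; rewrite -(PU i x) /marginal mulr_suml.
    by apply: eq_bigr => a /eqP->.
  by rewrite -mulr_sumr -ln_prod // d1 ln1 mulr0.
have minp a : a \in S -> 0 < Num.min 1 (s a) by move=> Sa; rewrite lt_min ltr01 pos.
have Mp : 0 < \prod_(a in S) Num.min 1 (s a) by apply: prodr_gt0.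
rewrite -ler_ln ?posrE //; apply: le_trans geo; rewrite split_ln.
rewrite ln_prod //.
rewrite [leRHS](bigID (mem S)) /= [X in _ + X]big1 ?addr0 => [|a nSa]; last first.
  by rewrite PS ?mul0r.
apply: ler_sum => a Sa.
apply: (@le_trans _ _ (P a * ln (Num.min 1 (s a)))).
  by apply: ler_niMl => //; apply: ln_le0; rewrite ge_min lexx.
by apply: ler_wpM2l => //; rewrite ler_ln ?posrE ?minp ?pos // ge_min lexx orbT.
Qed.

Implicit Types U g : forall i, 'M[C]_(n i).

Definition adj_kernel U i (x y : 'I_(n i)) : C := (U i y x)^*.

Lemma unitary_tensK U (X : W -> C) b : (forall i, U i \is unitarymx) ->
  tens (fun i x y => U i x y) (tens (@adj_kernel U) X) b = X b.
Proof.
move=> uU; rewrite tens_comp -[RHS]tens_delta; apply: eq_tens => // i x z.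
have /unitarymxP : (U i)^t* \is unitarymx by rewrite trmxC_unitary.
rewrite trmxCK => /matrixP/(_ x z); rewrite !mxE /kdelta => <-.
by apply: eq_bigr => y _; rewrite !mxE.
Qed.

(* With U unitary and U g = V having orthogonal rows, g = U^* V, so the norm of g t is
   a weighted sum over the coordinates of t in the basis of the rows of U. *)
Lemma nrm2_spectral g (X : W -> C) : (forall i, `|\det (g i)| = 1) ->
  exists U (d : forall i, 'I_(n i) -> R),
    [/\ forall i, U i \is unitarymx, forall i x, 0 < d i x, forall i, \prod_x d i x = 1 &
      nrm2 (tens g X) =
        (\sum_(a : W) (\prod_i d i (a i)) * sqn (tens (@adj_kernel U) X a))%:C].
Proof.
move=> dg.
pose U i := spectralmx (g i *m (g i)^t*).
have [V VE] : exists V : forall i, 'M[C]_(n i), forall i, V i = U i *m g i.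
  by exists (fun i => U i *m g i).
pose D i := spectral_diag (g i *m (g i)^t*).
have uU i : U i \is unitarymx by apply: spectral_unitarymx.
have UU i : U i *m (U i)^t* = 1%:M by apply/unitarymxP.
have VV i : V i *m (V i)^t* = diag_mx (D i).
  have nA : g i *m (g i)^t* \is normalmx.
    by apply/normalmxP; rewrite adjmxM trmxCK.
  have /orthomx_spectralP AE := nA.
  rewrite VE adjmxM mulmxA -(mulmxA (U i)) AE -/(U i) -/(D i) invmx_unitary //.
  by rewrite !mulmxA UU mul1mx -mulmxA UU mulmx1.
have dE i x : D i 0 x = (\sum_y sqn (V i x y))%:C.
  have /matrixP/(_ x x) := VV i; rewrite !mxE eqxx mulr1n => <-.
  rewrite rmorph_sum; apply: eq_bigr => y _.
  by rewrite !mxE -normCK normCsqn.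
pose d i x : R := \sum_y sqn (V i x y).
have d0 i x : 0 <= d i x by apply: sumr_ge0 => y _; apply: sqn_ge0.
have dp i : \prod_x d i x = 1.
  apply: (@complexI R); rewrite rmorph1; transitivity (\prod_x D i 0 x).
    by rewrite rmorph_prod; apply: eq_bigr => x _; rewrite dE.
  rewrite -det_diag -VV det_mulmx det_map_mx det_tr -normCK.
  have nU : `|\det (U i)| ^+ 2 = 1 by rewrite -(det1 C (n i)) -(UU i) det_mulmx det_map_mx det_tr -normCK.
  by rewrite VE det_mulmx normrM dg mulr1 nU.
exists U, d; split=> // [i x|].
  rewrite lt_neqAle d0 andbT eq_sym; apply/eqP => e.
  by have := oner_neq0 R; rewrite -(dp i) (bigD1 x) //= e mul0r eqxx.
have gE i x y : g i x y = kmul (@adj_kernel U i) (fun x y => V i x y) x y.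
  transitivity (((U i)^t* *m V i) x y).
    rewrite VE mulmxA (_ : (U i)^t* *m U i = 1%:M) ?mul1mx //.
    have /unitarymxP : (U i)^t* \is unitarymx by rewrite trmxC_unitary.
    by rewrite trmxCK.
  by rewrite mxE; apply: eq_bigr => z _; rewrite !mxE.
transitivity (nrm2 (tens (fun i x y => V i x y) (tens (@adj_kernel U) X))).
  by apply: eq_bigr => w _; rewrite tens_comp; congr (`| _ | ^+ 2); apply: eq_tens => // i x y.
rewrite nrm2_tens.
transitivity (quad (fun i x y => kdelta C x y * (d i x)%:C) (tens (@adj_kernel U) X)).
  apply: eq_quad => i x y; have /matrixP/(_ x y) := VV i; rewrite !mxE => e.
  rewrite /kdelta -dE mulr_natl -e.
  by apply: eq_bigr => z _; rewrite !mxE.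
rewrite /quad rmorph_sum; apply: eq_bigr => a _.
rewrite (bigD1 a) //= [X in _ + X]big1 ?addr0 => [|b nba].
  under eq_bigr do rewrite /kdelta eqxx mul1r.
  by rewrite -normCK normCsqn rmorphM rmorph_prod mulrC.
have [i nbai] : exists i, a i != b i.
  apply/existsP; apply: contraNT nba => /existsPn e.
  by apply/eqP/ffunP => i; apply/esym/eqP/negPn/e.
by rewrite (bigD1 i) //= /kdelta (negPf nbai) !mul0r mulr0.
Qed.

Lemma unitary_coordinates U (t : tensor R n) : (forall i, U i \is unitarymx) ->
  is_bases U /\ is_coordinates U t [ffun a => tens (@adj_kernel U) t a].
Proof.
move=> uU; split=> [i|b]; first exact: unitarymx_unit.
rewrite -[LHS](unitary_tensK _ _ uU) /tens; apply: eq_bigr => a _.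
by rewrite ffunE.
Qed.

Lemma nrm2_lower_bound (t : tensor R n) :
    (forall (U : forall i, 'M[C]_(n i)) c, is_bases U -> is_coordinates U t c ->
       uniform_support R (tensor_supp c)) ->
  exists2 mu : R, 0 < mu & forall g, (forall i, `|\det (g i)| = 1) ->
    mu%:C <= nrm2 (tens g t).
Proof.
move=> good.
pose I := ({i : 'I_k & 'I_(n i) * 'I_(n i)} * bool)%type.
pose entry (i : 'I_k) (x y : 'I_(n i)) : {i : 'I_k & 'I_(n i) * 'I_(n i)}%type :=
  Tagged (fun i => 'I_(n i) * 'I_(n i))%type (x, y).
pose U (f : I -> R) i : 'M[C]_(n i) :=
  \matrix_(x, y) (f (entry i x y, true) +i* f (entry i x y, false)).
pose co f a := tens (@adj_kernel (U f)) t a.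
(* All candidate supports are summed to keep [F] continuous; where [U f] is unitary, the summand of
   the actual support is positive. *)
pose F (f : I -> R) := \sum_(S : {set W} | `[< uniform_support R S >])
  \prod_(a in S) Num.min 1 (sqn (co f a)).
pose h (f : I -> R) := \sum_i \sum_x \sum_y
  sqn (\sum_z U f i x z * (U f i y z)^* - (x == y)%:R).
have cU i x y : @ccont R {ptws I -> R} (fun f => U f i x y).
  split.
    by rewrite (_ : (fun _ => _) = fun f => f (entry i x y, true)); [apply: rcont_proj|apply/funext => f; rewrite mxE].
  by rewrite (_ : (fun _ => _) = fun f => f (entry i x y, false)); [apply: rcont_proj|apply/funext => f; rewrite mxE].
have cco a : @ccont R {ptws I -> R} (fun f => co f a).
  apply: ccont_sum => b; apply: ccontM; first exact: ccont_cst.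
  by apply: ccont_prod => i; apply: ccont_conj.
have cF : continuous (F : {ptws I -> R} -> R).
  apply: rcont_sum => S; apply: rcont_prod => a; apply: rcont_min; first exact: rcont_cst.
  exact: rcont_sqn.
have ch : continuous (h : {ptws I -> R} -> R).
  apply: rcont_sum => i; apply: rcont_sum => x; apply: rcont_sum => y.
  apply: rcont_sqn; apply: ccontD; last exact: ccont_cst.
  by apply: ccont_sum => z; apply: ccontM => //; apply: ccont_conj.
have hU f : h f = 0 -> forall i, U f i \is unitarymx.
  move=> h0 i; apply/unitarymxP/matrixP => x y.
  have s1 i' x' : 0 <= \sum_y' sqn (\sum_z U f i' x' z * (U f i' y' z)^* - (x' == y')%:R).
    by apply: sumr_ge0 => y' _; apply: sqn_ge0.
  move/eqP: h0; rewrite psumr_eq0 => [/allP/(_ i)|i' _]; last by apply: sumr_ge0.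
  rewrite mem_index_enum => /(_ isT); rewrite psumr_eq0 => [/allP/(_ x)|//].
  rewrite mem_index_enum => /(_ isT); rewrite psumr_eq0 => [/allP/(_ y)|y' _]; last exact: sqn_ge0.
  rewrite mem_index_enum sqn_eq0 subr_eq0 => /(_ isT)/eqP e.
  rewrite mxE [RHS]mxE -e; apply: eq_bigr => z _; congr (_ * _).
  by rewrite [LHS]mxE; congr (_^*); rewrite mxE.
have term_ge0 f (S : {set W}) : 0 <= \prod_(a in S) Num.min 1 (sqn (co f a)).
  by apply: prodr_ge0 => a _; rewrite le_min ler01 sqn_ge0.
have pos f : (forall i, `|f i| <= 1) -> h f = 0 -> 0 < F f.
  move=> _ /hU uU; have [bU cU'] := unitary_coordinates t uU.
  have S0 := good _ _ bU cU'.
  rewrite /F (bigD1 (tensor_supp [ffun a => tens (@adj_kernel (U f)) t a])) /=; last exact/asboolP.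
  rewrite ltr_pwDl ?sumr_ge0 //; apply: prodr_gt0 => a.
  rewrite inE ffunE => nz; rewrite lt_min ltr01 lt_neqAle sqn_ge0 andbT eq_sym.
  by rewrite sqn_eq0.
have [mu mu0 muF] := box_min cF ch pos.
(* By AM-GM each summand of [F] is at most the norm, and there are at most [N] of them. *)
pose N := #|{: {set W}}|.
have N0 : 0 < N%:R :> R by rewrite ltr0n; apply/card_gt0P; exists finset.set0.
exists (mu / N%:R) => [|g dg]; first exact: divr_gt0.
have [U' [d [uU' d0 d1 ->]]] := nrm2_spectral t dg.
rewrite lecR ler_pdivrMr //.
pose f (q : I) : R := let z := U' (tag q.1) (tagged q.1).1 (tagged q.1).2 in
  if q.2 then complex.Re z else complex.Im z.
have Uf i x y : U f i x y = U' i x y by rewrite mxE /f /=; case: (U' i x y).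
have cof a : co f a = tens (@adj_kernel U') t a.
  by apply: eq_tens => // i x y; rewrite /adj_kernel Uf.
have rowsum i x y : \sum_z U' i x z * (U' i y z)^* = (x == y)%:R.
  have /unitarymxP/matrixP/(_ x y) := uU' i; rewrite [RHS]mxE => <-.
  by rewrite mxE; apply: eq_bigr => z _; rewrite !mxE.
have box q : `|f q| <= 1.
  case: q => [[i [x y]] b].
  have le1 : sqn (U' i x y) <= 1.
    have := rowsum i x x; rewrite eqxx => e.
    rewrite -lecR -normCsqn -[X in _ <= X]e (bigD1 y) //= -normCK lerDl.
    by apply: sumr_ge0 => z _; rewrite -normCK exprn_ge0.
  have le x' y' : x' ^+ 2 + y' ^+ 2 <= 1 -> `|x'| <= 1 :> R.
    by rewrite ler_norml => l; apply/andP; split; nra.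
  rewrite /f /=; case: b; first exact: le le1.
  by apply: (le _ (complex.Re (U' i x y))); rewrite addrC.
have hf : h f = 0.
  rewrite /h big1 // => i _; rewrite big1 // => x _; rewrite big1 // => y _.
  under eq_bigr do rewrite !Uf.
  by rewrite rowsum subrr; apply/eqP; rewrite sqn_eq0.
apply: le_trans (muF f box hf) _; rewrite /F big_mkcond /=.
rewrite mulr_natr -sumr_const; apply: ler_sum => S _.
set Z := \sum_a _; have Z0 : 0 <= Z.
  by apply: sumr_ge0 => a _; rewrite mulr_ge0 ?sqn_ge0 // prodr_ge0 // => i _; apply: ltW.
case: ifP => // /asboolP uS; under eq_bigr do rewrite cof.
by apply: uniform_support_amgm => // a; apply: sqn_ge0.
Qed.

End NormLowerBound.

(** Eliminating the lower left block of [M], or the upper right one, evaluates its determinant in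
    two ways. *)
Lemma det_1D_mul (K : comNzRingType) m (A : 'cV[K]_m) (B : 'rV[K]_m) :
  \det (1%:M + A *m B) = 1 + (B *m A) 0 0.
Proof.
pose M := block_mx 1%:M A (- B) 1%:M.
have e1 : \det M = \det (1%:M + A *m B).
  have := congr1 determinant (mulmx_block 1%:M (- A) 0 1%:M 1%:M A (- B) 1%:M).
  rewrite det_mulmx det_ublock !det1 !mul1r -/M => ->.
  rewrite !mul1mx !mul0mx !mulmx1 mulNmx mulmxN opprK subrr !add0r.
  by rewrite det_lblock det1 mulr1.
have := congr1 determinant (mulmx_block 1%:M 0 B 1%:M 1%:M A (- B) 1%:M).
rewrite det_mulmx det_lblock !det1 !mul1r -/M -e1 => ->.
rewrite !mul1mx !mul0mx !mulmx1 subrr !addr0.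
by rewrite det_ublock det1 mul1r [_ + 1%:M]mx11_scalar det_scalar1 !mxE addrC.
Qed.

Lemma finite_pos_min (R : realFieldType) (I : finType) (e : I -> R) : (forall i, 0 < e i) ->
  exists2 eta, 0 < eta <= 1 & forall i, eta <= e i.
Proof.
move=> e0; pose s := 1 + \sum_i (e i)^-1.
have s1 : 1 <= s by rewrite lerDl sumr_ge0 // => i _; rewrite invr_ge0 ltW.
have s0 : 0 < s by apply: lt_le_trans s1.
exists s^-1; first by rewrite invr_gt0 s0 invf_le1.
move=> i; rewrite invf_ple ?posrE // /s (bigD1 i) //= addrCA lerDl addr_ge0 //.
by apply: sumr_ge0 => j _; rewrite invr_ge0 ltW.
Qed.

Lemma bernoulli (R : realFieldType) (e : R) m : 0 <= e -> 1 + m%:R * e <= (1 + e) ^+ m.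
Proof.
move=> e0; elim: m => [|m IH]; first by rewrite mul0r addr0.
have m0 : 0 <= m%:R :> R by [].
have e1 : 0 <= 1 + e by lra.
have := ler_wpM2l e1 IH; rewrite -exprS => h; apply: le_trans h.
rewrite -natr1; nra.
Qed.

(* Scaling a direction whose weight exceeds the fair share 1/n by the factor 1 + delta,
   with determinant one, contracts the norm; b and a are the squares of the factors. *)
Lemma balance_gain (R : realFieldType) (n : nat) (delta : R) : (0 < n)%N -> 0 < delta ->
  let b := 1 + delta / n%:R in let a := (b ^+ n.-1)^-1 in
  a <= b /\ b + (a - b) * ((1 + delta) / n%:R) < 1.
Proof.
case: n => // n _ d0 b a; set N : R := n.+1%:R in b a *.
have N1 : 1 <= N by rewrite ler1n.
have nN : n%:R = N - 1 by rewrite /N -natr1 addrK.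
have e0 : 0 < delta / N by rewrite divr_gt0 //; lra.
have bn : 1 + (N - 1) * (delta / N) <= b ^+ n by rewrite -nN; apply: bernoulli; apply: ltW.
have b1 : 1 <= b by rewrite lerDl ltW.
have bn1 : 1 <= b ^+ n by apply: exprn_ege1.
have a1 : a <= 1 by rewrite invf_le1 // (lt_le_trans _ bn1).
split; first exact: le_trans b1.
set e := delta / N in b a e0 bn b1 bn1 a1 *.
have c0 : 0 < 1 + (N - 1) * e by nra.
have ac : a <= (1 + (N - 1) * e)^-1.
  by rewrite lef_pV2 ?posrE // (lt_le_trans _ bn).
have dE : delta = N * e by rewrite /e mulrC divfK //; lra.
apply: (@le_lt_trans _ _ (b + ((1 + (N - 1) * e)^-1 - b) * ((1 + delta) / N))).
  by rewrite lerD2l ler_wpM2r ?lerD2r // divr_ge0 //; lra.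
rewrite -subr_gt0.
have -> : 1 - (b + ((1 + (N - 1) * e)^-1 - b) * ((1 + delta) / N)) =
    e * e * (2 * N - 1 + N * (N - 1) * e) / (N * (1 + (N - 1) * e)).
  by rewrite dE /b; field; lra.
have N0 : 0 < N by lra.
have h : 0 <= N * (N - 1) * e by rewrite mulr_ge0 ?(ltW e0) // mulr_ge0 ?subr_ge0 // ltW.
have g0 : 0 < 2 * N - 1 + N * (N - 1) * e by lra.
apply: divr_gt0; first by apply: mulr_gt0 => //; apply: mulr_gt0.
exact: mulr_gt0.
Qed.

(** * Near-minimizers of the norm *)

Section Balance.
Variables (R : realType) (k : nat) (n : 'I_k -> nat).
Local Notation W := (multi_index n).
Local Notation C := R[i].
Local Open Scope complex_scope.
Local Open Scope ring_scope.

Lemma normC_real (T : finType) (X : T -> C) : nrm2 X = (\sum_w sqn (X w))%:C.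
Proof. by rewrite rmorph_sum; apply: eq_bigr => w _; rewrite normCsqn. Qed.

Section Scaling.
Variables (m : nat) (u : 'cV[C]_m) (r x y : C).
Hypothesis ur : u^t* *m u = r%:M.
Hypotheses (r0 : r != 0) (rr : r^* = r) (xr : x^* = x) (yr : y^* = y).

(** Multiplies the direction [u], of squared norm [r], by [x] and its orthogonal complement by
    [y]. *)
Definition scaling : 'M[C]_m := y%:M + ((x - y) / r) *: (u *m u^t*).

Lemma scaling_det : (0 < m)%N -> y != 0 -> \det scaling = x * y ^+ m.-1.
Proof.
move=> m0 y0.
have -> : scaling = y *: (1%:M + ((x - y) / r / y *: u) *m u^t*).
  rewrite /scaling scalerDr -scalemxAl scalerA scalemx1; congr (_ + _ *: _).
  by rewrite mulrCA divff // mulr1.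
rewrite detZ det_1D_mul -scalemxAr ur !mxE eqxx mulr1n -[in y ^+ m](prednK m0) exprS.
by field; rewrite y0 r0.
Qed.

Lemma scaling_gram : scaling *m scaling^t* =
  (y ^+ 2)%:M + ((x ^+ 2 - y ^+ 2) / r) *: (u *m u^t*).
Proof.
have -> : scaling^t* = scaling.
  rewrite /scaling linearD linearZ /= map_mxD map_mxZ tr_scalar_mx map_scalar_mx adjmxM trmxCK.
  by rewrite rmorphM rmorphB fmorphV /= xr yr rr.
rewrite /scaling mulmxDl !mulmxDr -!scalar_mxM mul_scalar_mx mul_mx_scalar.
rewrite -scalemxAl -scalemxAr -mulmxA (mulmxA _ u) ur mul_scalar_mx -scalemxAr !scalerA.
rewrite -addrA -expr2 -!scalerDl; congr (_ + _ *: _).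
by field.
Qed.

Lemma scaling_norm (v : 'rV[C]_m) : \sum_z `|(v *m scaling) 0 z| ^+ 2 =
  y ^+ 2 * (\sum_z `|v 0 z| ^+ 2) + (x ^+ 2 - y ^+ 2) / r * `|(v *m u) 0 0| ^+ 2.
Proof.
have nE p (w : 'rV[C]_p) : \sum_z `|w 0 z| ^+ 2 = (w *m w^t*) 0 0.
  by rewrite mxE; apply: eq_bigr => z _; rewrite !mxE normCK.
rewrite !nE adjmxM mulmxA -(mulmxA v) scaling_gram mulmxDr mulmxDl mul_mx_scalar.
rewrite -scalemxAr -!scalemxAl [LHS]mxE; congr (_ + _); first by rewrite mxE.
rewrite mxE !mulmxA -(mulmxA (v *m u)) -adjmxM normCK; congr (_ * _).
by rewrite mxE big_ord1; congr (_ * _); rewrite [LHS]mxE; congr (_^*); rewrite mxE.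
Qed.

End Scaling.
Lemma nrm2_scaled_leg (X : W -> C) j (u : 'cV[C]_(n j)) (r x y : C)
    (M : forall i, 'I_(n i) -> 'I_(n i) -> C) :
    u^t* *m u = r%:M -> r != 0 -> r^* = r -> x^* = x -> y^* = y ->
    M j =2 scaling u r x y ->
  nrm2 (tens (leg j M) X) *+ n j = y ^+ 2 * (nrm2 X *+ n j) +
    (x ^+ 2 - y ^+ 2) / r * \sum_w `|\sum_(z : 'I_(n j)) X (subst_leg w z) * u z 0| ^+ 2.
Proof.
move=> ur r0 rr xr yr ME.
have sl (f : W -> C) : \sum_w \sum_(z : 'I_(n j)) f (subst_leg w z) = (\sum_w f w) *+ n j.
  by have := sum_subst_leg j f; rewrite card_ord.
rewrite /nrm2 -!sl !mulr_sumr -big_split /=; apply: eq_bigr => w _.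
pose v : 'rV[C]_(n j) := \row_z X (subst_leg w z).
have := scaling_norm ur r0 rr xr yr v.
rewrite [(v *m u) 0 0]mxE.
under [in X in _ = _ * X + _]eq_bigr do rewrite mxE.
under [in X in _ = _ + _ * `| X | ^+ 2]eq_bigr do rewrite mxE.
move=> <-; apply: eq_bigr => z _; rewrite tens_leg subst_leg_in [(v *m _) 0 z]mxE.
by congr (`| _ | ^+ 2); apply: eq_bigr => z' _; rewrite subst_legK ME [v 0 z']mxE.
Qed.

(** Take [g] within a factor [1 + eta] of the infimum. A direction violating the bound could be
    scaled down with determinant one, multiplying the norm by at most [1 - eta]; as
    [(1 + eta) * (1 - eta) < 1], this would fall below the infimum. *)
Lemma balanced_near_minimizer (t : W -> C) (mu delta : R) : 0 < mu -> 0 < delta ->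
    (forall g : forall i, 'M[C]_(n i), (forall i, `|\det (g i)| = 1) -> mu%:C <= nrm2 (tens g t)) ->
  exists (g : forall i, 'M[C]_(n i)) (N : R), [/\ 0 < N, nrm2 (tens g t) = N%:C &
    forall j, leg_bound (tens g t) j (((1 + delta) / (n j)%:R * N)%:C)].
Proof.
move=> mu0 d0 lower.
pose val (g : forall i, 'M[C]_(n i)) : R := complex.Re (nrm2 (tens g t)).
have valE (g : forall i, 'M[C]_(n i)) : nrm2 (tens g t) = (val g)%:C by rewrite /val normC_real.
pose A := [set v : R | exists2 g, (forall i, `|\det (g i)| = 1) & v = val g]%classic.
have lbA : lbound A mu by move=> _ [g dg ->]; rewrite -lecR -valE; apply: lower.
have A0 : A (val (fun i => 1%:M)).
  by exists (fun i => 1%:M) => // i; rewrite det1 normr1.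
have infA : has_inf A by split; [exists (val (fun i => 1%:M))|exists mu].
have nu0 : 0 < inf A by apply: lt_le_trans mu0 _; apply: lb_le_inf => //; exists (val (fun i => 1%:M)).
pose b j : R := 1 + delta / (n j)%:R.
pose a j : R := (b j ^+ (n j).-1)^-1.
(* The relative gain from [balance_gain]; a leg of dimension zero gets the harmless positive value
   [1]. *)
pose e j : R := if (0 < n j)%N then 1 - (b j + (a j - b j) * ((1 + delta) / (n j)%:R)) else 1.
have e0 j : 0 < e j.
  by rewrite /e; case: ifP => // nj; rewrite subr_gt0; case: (balance_gain nj d0).
have [eta /andP[eta0 eta1] etae] := finite_pos_min e0.
have [_ [g dg ->] gN] := inf_adherent (mulr_gt0 eta0 nu0) infA.
have N0 : 0 < val g by rewrite -ltcR -valE; apply: lt_le_trans (lower g dg); rewrite ltcR.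
exists g, (val g); split=> // j u.
set N := val g in gN N0 *.
have [nj|nj] := posnP (n j).
  rewrite [X in _ *+ X](_ : _ = 0%N) ?card_ord // mulr0n big1 // => w _.
  by have := ltn_ord (w j); rewrite [X in (_ < X)%N]nj.
rewrite card_ord normC_real.
set r : R := \sum_x sqn (u x).
have nR : 0 < (n j)%:R :> R by rewrite ltr0n.
pose q : R := \sum_(w : W) sqn (\sum_(x : 'I_(n j)) tens g t (subst_leg w x) * u x).
have qE : \sum_(w : W) `|\sum_(x : 'I_(n j)) tens g t (subst_leg w x) * u x| ^+ 2 = q%:C.
  exact: normC_real.
rewrite qE -rmorphM -rmorphMn lecR -mulr_natr.
have -> : (1 + delta) / (n j)%:R * N * r * (n j)%:R = (1 + delta) * N * r by field; lra.
have r_ge0 : 0 <= r by apply: sumr_ge0 => x _; apply: sqn_ge0.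
have [r0|rn0] := eqVneq r 0.
  have u0 x : u x = 0.
    apply/eqP; rewrite -sqn_eq0; move/eqP: r0; rewrite psumr_eq0 => [/allP/(_ x)|y _].
      by rewrite mem_index_enum => /(_ isT).
    exact: sqn_ge0.
  rewrite r0 mulr0 /q big1 // => w _; apply/eqP; rewrite sqn_eq0 big1 // => x _.
  by rewrite u0 mulr0.
have rp : 0 < r by rewrite lt_neqAle eq_sym rn0.
rewrite leNgt; apply/negP => qbig.
have [ab fb] := balance_gain nj d0; rewrite -/(b j) -/(a j) in ab fb.
have b1 : 1 <= b j by rewrite lerDl divr_ge0 // ltW.
(* Square roots of the factors in [balance_gain], so that [x * y ^+ (n j).-1 = 1]. *)
pose y := Num.sqrt (b j); pose x := (y ^+ (n j).-1)^-1.
have y2 : y ^+ 2 = b j by rewrite sqr_sqrtr //; lra.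
have y0 : 0 < y by rewrite sqrtr_gt0; lra.
have x2 : x ^+ 2 = a j by rewrite /x /a -y2 exprVn -!exprM mulnC.
pose uc : 'cV[C]_(n j) := \col_z u z.
have ur : uc^t* *m uc = (r%:C)%:M.
  rewrite [LHS]mx11_scalar; congr _%:M; rewrite mxE /r rmorph_sum.
  by apply: eq_bigr => z _; rewrite !mxE -[_ z]/(u z) mulrC -normCK normCsqn.
have cr (z : R) : (z%:C)^* = z%:C by rewrite -[LHS]/(conjc _) conjc_real.
have rC0 : r%:C != 0 by rewrite (inj_eq (@complexI R) r 0).
have yC0 : y%:C != 0 by rewrite (inj_eq (@complexI R) y 0) gt_eqF.
pose H := scaling uc r%:C x%:C y%:C.
have dH : \det H = 1.
  rewrite /H (scaling_det _ ur) // -rmorphXn -rmorphM /x mulVf ?rmorph1 //.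
  by rewrite expf_neq0 // gt_eqF.
pose K i : 'M[C]_(n i) :=
  @dfwith _ (fun i => 'M[C]_(n i)) (fun i => 1%:M) j H i.
pose g' i := g i *m K i.
have dg' i : `|\det (g' i)| = 1.
  rewrite det_mulmx normrM dg mul1r /K; case: dfwithP => [|i' _]; last by rewrite det1 normr1.
  by rewrite dH normr1.
have g'E : nrm2 (tens g' t) = nrm2 (tens (leg j (fun i x y => K i x y)) (tens g t)).
  apply: eq_bigr => w _; congr (`| _ | ^+ 2); rewrite tens_comp; apply: eq_tens => // i z z'.
  rewrite /g' mxE; apply: eq_bigr => z'' _; rewrite /leg; case: eqVneq => // ij.
  by rewrite /K dfwith_out 1?eq_sym // mxE.
have cE (x' y' r' q' N' n' : R) : (y' ^+ 2 * (N' * n') + (x' ^+ 2 - y' ^+ 2) / r' * q')%:C =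
    y'%:C ^+ 2 * (N'%:C * n'%:C) + (x'%:C ^+ 2 - y'%:C ^+ 2) / r'%:C * q'%:C.
  by rewrite rmorphD !rmorphM rmorphB !rmorphXn fmorphV.
have scaled : val g' * (n j)%:R = y ^+ 2 * (N * (n j)%:R) + (x ^+ 2 - y ^+ 2) / r * q.
  apply: (@complexI R).
  have KH : (fun z z' => K j z z') =2 scaling uc r%:C x%:C y%:C.
    by move=> z z'; rewrite /K dfwith_in.
  have := @nrm2_scaled_leg (tens g t) j uc r%:C x%:C y%:C (fun i x y => K i x y)
    ur rC0 (cr r) (cr x) (cr y) KH.
  have -> : \sum_(w : W) `|\sum_(z < n j) tens g t (subst_leg w z) * uc z 0| ^+ 2 = q%:C.
    rewrite -qE; apply: eq_bigr => w _; congr (`| _ | ^+ 2).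
    by apply: eq_bigr => z _; rewrite mxE.
  rewrite -g'E !valE -/N -[(val g')%:C *+ _]mulr_natr -[N%:C *+ _]mulr_natr => e1.
  rewrite rmorphM rmorph_nat [LHS]e1.
  by rewrite cE rmorph_nat.
have qr : (a j - b j) / r * q <= (a j - b j) * ((1 + delta) * N).
  rewrite -mulrA; apply: ler_wnM2l; first by rewrite subr_le0.
  by rewrite [_^-1 * q]mulrC ler_pdivlMr // ltW.
have val_le : val g' <= N * (b j + (a j - b j) * ((1 + delta) / (n j)%:R)).
  rewrite -(ler_pM2r nR) scaled y2 x2.
  have -> : N * (b j + (a j - b j) * ((1 + delta) / (n j)%:R)) * (n j)%:R =
      b j * (N * (n j)%:R) + (a j - b j) * ((1 + delta) * N) by field; lra.
  by rewrite lerD2l.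
have nu_le : inf A <= val g' by apply: ge_inf; [case: infA|exists g'].
have := etae j; rewrite /e nj => ej.
have : N * (b j + (a j - b j) * ((1 + delta) / (n j)%:R)) <= N * (1 - eta).
  by rewrite ler_pM2l //; lra.
have : N * (1 - eta) <= (inf A + eta * inf A) * (1 - eta).
  by apply: ler_wpM2r; [rewrite subr_ge0|apply: ltW].
have : 0 < eta * eta * inf A by rewrite !mulr_gt0.
nra.
Qed.

End Balance.

(** * Comparison of the functionals *)

Section QuantumFunctional.
Variables (R : realType) (k : nat) (n : 'I_k -> nat) (theta : 'I_k -> R).
Hypothesis theta_dist : is_dist theta.
Hypothesis theta_gt0 : forall i, 0 < theta i.
Local Notation C := R[i].
Local Open Scope complex_scope.
Local Open Scope ring_scope.

Lemma normalized_partition_dist m la : (0 < m)%N -> is_partition m la ->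
  is_dist (@normalized_partition R m la).
Proof.
move=> m0 /and3P[_ _ /eqP lam]; split=> [i|]; first by rewrite divr_ge0.
rewrite -mulr_suml -natr_sum.
have -> : (\sum_(i < size la) nth 0 la i)%N = m.
  by rewrite -lam sumnE (big_nth 0%N) big_mkord.
by rewrite divff // pnatr_eq0 -lt0n.
Qed.

(** A nonzero part needs a nonzero projector on every leg, hence at most [n j] rows in [la j]. *)
Lemma isotypic_part_entropy_le (t : tensor R n) m la : (0 < m)%N ->
    (forall j, is_partition m (la j)) -> isotypic_part t m la != 0 ->
  \sum_j theta j * entropy (@normalized_partition R m (la j)) <= max_exponent n theta.
Proof.
move=> m0 lam nz; apply: ler_sum => j _; apply: ler_wpM2l; first exact: ltW.
have pj : isotypic_proj C (n j) m (la j) != 0.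
  apply: contraNneq nz => p0; apply/eqP/ffunP => w; rewrite !ffunE big1 // => v _.
  by rewrite (bigD1 j) //= p0 mxE mul0r mulr0.
have sz := isotypic_proj_size (lam j) pj.
have dj := normalized_partition_dist m0 (lam j).
apply: le_trans (entropy_le dj) _; rewrite card_ord /log2.
have s0 : (0 < size (la j))%N.
  rewrite lt0n; apply/eqP => s0; case: dj => _; rewrite big1 => [/eqP|i _].
    by rewrite eq_sym oner_eq0.
  by have := ltn_ord i; rewrite {2}s0.
rewrite ler_pM2r ?invr_gt0 ?ln2_gt0 // ler_ln ?posrE ?ltr0n ?ler_nat //.
exact: leq_trans sz.
Qed.

Lemma exists_isotypic_part (t : tensor R n) (mu eps : R) :
    (forall i, 0 < n i)%N -> 0 < mu -> 0 < eps ->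
    (forall g : forall i, 'M[C]_(n i), (forall i, `|\det (g i)| = 1) ->
       mu%:C <= nrm2 (tens g t)) ->
  exists (m : nat) (la : 'I_k -> seq nat), [/\ (0 < m)%N, forall j, is_partition m (la j),
    isotypic_part t m la != 0 &
    forall j, log2 (n j)%:R - eps <= entropy (@normalized_partition R m (la j))].
Proof.
move=> n0 mu0 eps0 lower.
have l2 := ln2_gt0 R.
(* Half of [eps], in natural units. Up to polynomial factors the low-entropy subspace of leg [i] has
   rank [n i ^ m * expR (-2 * m * eta)]; the power [(1 + delta) ^ m = expR (m * eta)] leaves a decay
   of [expR (- m * eta)]. *)
pose eta : R := eps * ln 2 / 2.
have eta0 : 0 < eta by rewrite divr_gt0 ?mulr_gt0.
pose delta := expR eta - 1.
have delta0 : 0 < delta by rewrite subr_gt0 expR_gt1.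
have [g [N [N0 NE bal]]] := balanced_near_minimizer mu0 delta0 lower.
(* One polynomial exponent for all legs: [n i * n i] from the rank of a symmetrizer and [n i] from
   the number of types. *)
pose D := (\sum_i (n i * n i + n i))%N.
have [m m0 small] := @poly_expR_small R D k%:R eta (ler0n _ _) eta0.
pose a i : R := log2 (n i)%:R - eps.
pose P i : pred (word (n i) m) := [pred w | `[< entropy (word_type R w) < a i >]].
pose good i la := ~~ `[< entropy (@normalized_partition R m la) < a i >].
have P_place i (w : word (n i) m) s : P i (place_word w s) = P i w.
  rewrite /P /=; congr `[< entropy _ < _ >]; apply/funext => x.
  by rewrite /word_type letter_count_place.
have P_bad i la (w : word (n i) m) : is_partition m la -> ~~ good i la ->
    tab_row la =1 word_nat w -> P i w.
  move=> lam bad tw; rewrite /P /= -(entropy_normalized_partition R lam tw).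
  by rewrite negbK in bad.
have dec i := isotypic_decomposition C (P_place i) (P_bad i).
pose I i : finType := projT1 (cid (dec i)).
pose la i : I i -> seq nat := projT1 (cid (projT2 (cid (dec i)))).
have lam i x : is_partition m (la i x).
  by case: (projT2 (cid (projT2 (cid (dec i))))) => h _; apply: h.
pose G i := \sum_(x | good i (la i x)) isotypic_proj C (n i) m (la i x).
have GB i : (1%:M - G i <= row_space C (P i))%MS.
  by case: (projT2 (cid (projT2 (cid (dec i))))).
have [[x [gx nz]]|none] := pselect (exists x : mindex I,
    (forall i, good i (la i (x i))) /\ isotypic_part t m (fun i => la i (x i)) != 0).
  exists m, (fun i => la i (x i)); split=> // j.
  by rewrite leNgt; apply/negP => /asboolP; apply/negP; apply: gx.
exfalso.
(* Expanding the product of the sums [G i] yields the isotypic parts of [t] for tuples of good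
   partitions, all zero by assumption. *)
have G0 w : tens (fun i => kmx (G i)) (@xpow C k n m t) w = 0.
  have kG i (v v' : word (n i) m) : kmx (G i) v v' = \sum_x
      (if good i (la i x) then isotypic_proj C (n i) m (la i x) else 0) (enum_rank v) (enum_rank v').
    by rewrite /kmx /G summxE big_mkcond; apply: eq_bigr => x _; case: ifP; rewrite ?mxE.
  rewrite /tens; under eq_bigr => v _.
    under eq_bigr do rewrite kG.
    rewrite (prod_sum_dffun (fun i x => (if good i (la i x) then isotypic_proj C (n i) m (la i x) else 0)
      (enum_rank (v i)) (enum_rank (w i)))) mulr_sumr; over.
  rewrite exchange_big big1 // => x _ /=.
  have [gx|/forallPn[i bi]] := boolP [forall i, good i (la i (x i))]; last first.
    by rewrite big1 // => v _; rewrite (bigD1 i) //= (negPf bi) mxE mul0r mulr0.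
  have : isotypic_part t m (fun i => la i (x i)) = 0.
    apply/eqP/negPn/negP => nz; apply: none; exists x; split=> // i; exact: (forallP gx).
  move/ffunP/(_ w); rewrite !ffunE => e; rewrite -[RHS]e; apply: eq_bigr => v _.
  by congr (_ * _); apply: eq_bigr => i _; rewrite (forallP gx).
pose c i : R := (1 + delta) / (n i)%:R * N.
have nR i : 0 < (n i)%:R :> R by rewrite ltr0n.
have c_ge0 i : 0 <= c i.
  by apply: mulr_ge0; [apply: divr_ge0; rewrite ?ltW // ltr_pwDl // ltW|apply: ltW].
have cC i : 0 <= (c i)%:C by rewrite lecR.
have := @nrm2_power_le C k n m t g (fun i => row_space C (P i)) G (fun i => (c i)%:C)
  cC bal (fun i => @row_space_power C (n i) m (P i) (g i)) GB G0.
rewrite NE.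
have -> : \sum_i (\rank (row_space C (P i)))%:R * (c i)%:C ^+ m =
    (\sum_i (\rank (row_space C (P i)))%:R * c i ^+ m)%:C.
  by rewrite rmorph_sum; apply: eq_bigr => i _; rewrite [RHS]rmorphM rmorph_nat rmorphXn.
rewrite -rmorphXn lecR; apply/negP; rewrite -ltNge.
have Nm : 0 < N ^+ m by rewrite exprn_gt0.
apply: (@le_lt_trans _ _ (\sum_(i < k) m.+1%:R ^+ D * expR (- (m%:R * eta)) * N ^+ m)).
  apply: ler_sum => i _.
  have cm : 0 <= c i ^+ m by rewrite exprn_ge0.
  have cE : c i ^+ m = expR (m%:R * eta) / (n i)%:R ^+ m * N ^+ m.
    by rewrite /c /delta addrC subrK !exprMn exprVn expRM_natl.
  have e2 : expR (m%:R * ln 2 * a i) = (n i)%:R ^+ m * (expR (- (m%:R * eta)) * expR (- (m%:R * eta))).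
    rewrite -expRD -[(n i)%:R in RHS]lnK ?posrE // -expRM_natl -expRD; congr expR.
    by rewrite /a /log2 /eta; field; lra.
  have rk : (\rank (row_space C (P i)))%:R <=
      m.+1%:R ^+ (n i + n i * n i) * expR (m%:R * ln 2 * a i).
    apply: (@le_trans _ _ (#|P i| * m.+1 ^ (n i * n i))%:R); first by rewrite ler_nat rank_row_space.
    have := @card_low_entropy_words R (n i) m m0 (a i); rewrite -/(P i) => h.
    rewrite natrM exprD natrX mulrAC; apply: ler_wpM2r; first by rewrite exprn_ge0.
    by rewrite -natrX.
  apply: le_trans (ler_wpM2r cm rk) _; rewrite cE e2.
  have -> : m.+1%:R ^+ (n i + n i * n i) * ((n i)%:R ^+ m * (expR (- (m%:R * eta)) * expR (- (m%:R * eta)))) *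
      (expR (m%:R * eta) / (n i)%:R ^+ m * N ^+ m) =
      m.+1%:R ^+ (n i + n i * n i) * expR (- (m%:R * eta)) * N ^+ m.
    have nm : (n i)%:R ^+ m != 0 :> R by rewrite expf_neq0 // gt_eqF.
    by rewrite expRN; field; rewrite nm gt_eqF // expR_gt0.
  rewrite -!mulrA; apply: ler_wpM2r; first by rewrite mulr_ge0 ?expR_ge0 // ltW.
  apply: ler_weXn2l; first by rewrite ler1n.
  by rewrite /D (bigD1 i) //= [(n i + _)%N]addnC leq_addr.
rewrite sumr_const card_ord -[_ *+ k]mulr_natl !mulrA -[ltRHS]mul1r ltr_pM2r //.
by move: small; rewrite /eta !mulrA.
Qed.

Lemma quantum_exponent_ge (t : tensor R n) (mu : R) :
    (forall i, 0 < n i)%N -> 0 < mu ->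
    (forall g : forall i, 'M[C]_(n i), (forall i, `|\det (g i)| = 1) ->
       mu%:C <= nrm2 (tens g t)) ->
  max_exponent n theta <= quantum_exponent theta t.
Proof.
move=> n0 mu0 lower; rewrite /quantum_exponent; set A := (X in sup X).
(* Without an upper bound, [sup] would be a default value. *)
have ubA : has_ubound A.
  exists (max_exponent n theta) => _ [m [la [m0 lam nz ->]]]; apply: (isotypic_part_entropy_le m0 lam nz).
apply/ler_addgt0Pr => eps eps0.
have [m [la [m0 lam nz ent]]] := exists_isotypic_part n0 mu0 eps0 lower.
rewrite -lerBlDr.
apply: le_trans (ub_le_sup ubA _); last by exists m, la; split.
have [_ th1] := theta_dist.
rewrite -[eps]mul1r -th1 mulr_suml -sumrB; apply: ler_sum => i _.
by rewrite -mulrBr; apply: ler_wpM2l; [apply: ltW|apply: ent].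
Qed.

End QuantumFunctional.

Theorem theorem4p33 (R : realType) (k : nat) (n : 'I_k -> nat)
    (theta : 'I_k -> R) (t : tensor R n) :
  (3 <= k)%N ->
  is_dist theta ->
  (forall i, 0 < theta i) ->
  upper_quantum_functional theta t < \prod_i ((n i)%:R `^ theta i) ->
  upper_support_functional theta t < \prod_i ((n i)%:R `^ theta i).
Proof.
move=> _ theta_dist theta_gt0; rewrite !ltNge; apply: contra => zeta_ge.
(* A leg of dimension zero makes the product vanish, since [theta i > 0], and the quantum functional
   is nonnegative. *)
have [[i ni]|n0] := pselect (exists i, n i = 0%N).
  apply: (@le_trans _ _ 0); last first.
    by rewrite /upper_quantum_functional; case: ifP => // _; apply: powR_ge0.
  by rewrite (bigD1 i) //= ni powR0 ?mul0r // gt_eqF.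
have {}n0 i : (0 < n i)%N by rewrite lt0n; apply/eqP => ni; apply: n0; exists i.
move: zeta_ge; rewrite !(prod_powR_max_exponent theta n0).
rewrite /upper_quantum_functional /upper_support_functional.
(* For [t = 0] the support functional is [0], contradicting the assumed lower bound by a positive
   power. *)
have [_|t0] := eqVneq t 0; first by rewrite leNgt powR_gt0.
have powE x y : (2 `^ x <= 2 `^ y :> R) = (x <= y).
  by rewrite /powR pnatr_eq0 /= ler_expR ler_pM2r // ln2_gt0.
rewrite !powE => rho.
have [mu mu0 lower] := nrm2_lower_bound (fun U c bU cU =>
  uniform_support_of_exponent theta_gt0 t0 rho bU cU).
exact: (quantum_exponent_ge theta_dist theta_gt0 n0 mu0 lower).
Qed.
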